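(* Let $\varphi=\frac{1+\sqrt5}{2}$ and let $\alpha\in\mathbb{R}\setminus\mathbb{Q}$ satisfy $\mu(\alpha)-1\le\varphi$. Then, for all $\beta\in(0,1)$, $$\overline{\Gamma}(\alpha,\beta) = \overline{\Gamma}_{\mathcal{L}}(\alpha,\beta) = \frac{\mu(\alpha)-1}{\mu(\alpha)},$$ $$\underline{\Gamma}(\alpha,\beta) = \frac12, \qquad \text{and} \qquad \underline{\Gamma}_{\mathcal{L}}(\alpha,\beta) = \min\Bigl\{\frac12,\frac{1}{\mu(\alpha)-1}\Bigr\}.$$
   Context: Irrationality exponent: $\mu(\alpha)\in[2,\infty]$ is the supremum of $\mu\in\mathbb{R}$ for which $0<|\alpha-p/q|<q^{-\mu}$ has infinitely many solutions $p\in\mathbb{Z}$, $q\in\mathbb{N}$. Edit distance: for finite words $w,\tilde w$ over an alphabet, $\mathrm{d}_E(w,\tilde w)$ is half the minimal number of operations needed to transform $w$ into $\tilde w$, where an operation is the deletion or the insertion of a single letter at an arbitrary position. Coding: $\mathbb{T}=\mathbb{R}/\mathbb{Z}$ is identified with $[0,1)$, and $\mathcal{L}$ is Lebesgue measure on $\mathbb{T}$; $x \bmod 1$ is the unique element of $x+\mathbb{Z}$ in $[0,1)$. For $\alpha\in\mathbb{R}\setminus\mathbb{Q}$, $\beta\in(0,1)$, $x\in\mathbb{T}$, $n\in\mathbb{Z}$, let $\xi_n(x):=\mathbf{1}_{[0,\beta)}(x+n\alpha \bmod 1)$, and $\xi_{[0,N)}(x):=(\xi_n(x))_{n=0}^{N-1}\in\{0,1\}^N$.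 Put $d_N(x,y):=\mathrm{d}_E(\xi_{[0,N)}(x),\xi_{[0,N)}(y))$, $\mathcal{W}_N:=\{\xi_{[0,N)}(x):x\in\mathbb{T}\}$ and $\mathrm{diam}_E(\mathcal{W}_N):=\max_{x,y\in\mathbb{T}}d_N(x,y)$. Exponents: $\overline{\Gamma}(\alpha,\beta):=\limsup_{N\to\infty}\frac{\log \mathrm{diam}_E(\mathcal{W}_N)}{\log N}$ and $\underline{\Gamma}(\alpha,\beta):=\liminf_{N\to\infty}\frac{\log \mathrm{diam}_E(\mathcal{W}_N)}{\log N}$. The functions $(x,y)\mapsto\limsup_{N}\frac{\log d_N(x,y)}{\log N}$ and $(x,y)\mapsto\liminf_{N}\frac{\log d_N(x,y)}{\log N}$ are constant for $\mathcal{L}\times\mathcal{L}$-almost every $(x,y)\in\mathbb{T}^2$ (by ergodicity); these constants are denoted $\overline{\Gamma}_{\mathcal{L}}(\alpha,\beta)$ and $\underline{\Gamma}_{\mathcal{L}}(\alpha,\beta)$ respectively. *)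

(* Defs.v *)
From HB Require Import structures.
From mathcomp Require Export all_boot all_order all_algebra.
From mathcomp Require Export all_classical all_reals all_analysis.

Set Implicit Arguments.
Unset Strict Implicit.
Unset Printing Implicit Defensive.

Import Order.TTheory GRing.Theory Num.Theory.

Local Open Scope classical_set_scope.
Local Open Scope ring_scope.

Section EditDistance.
Context {A : Type}.
Implicit Types u v w : seq A.

Inductive edit_op : seq A -> seq A -> Prop :=
| edit_delete u a v : edit_op (u ++ a :: v) (u ++ v)
| edit_insert u a v : edit_op (u ++ v) (u ++ a :: v).

(* [edit_path n w w'] : [w] can be turned into [w'] by exactly [n] operations. *)
Fixpoint edit_path (n : nat) (w w' : seq A) : Prop :=
  if n is m.+1 then exists2 u, edit_op w u & edit_path m u w' else w = w'.

Lemma edit_path_exists w w' : exists n, `[< edit_path n w w' >].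
Proof.
suff [n wn] : exists n, edit_path n w w' by exists n; apply/asboolP.
elim: w => [|a w [n IH]]; last first.
  by exists n.+1; exists w => //; exact: (@edit_delete [::]).
suff H v : exists n, edit_path n v (v ++ w') by exact: (H [::]).
elim: w' v => [|b w' IH] v; first by exists 0%N; rewrite cats0.
have [n vn] := IH (rcons v b); exists n.+1, (rcons v b).
  by rewrite -cats1 -{1}(cats0 v); exact: edit_insert.
by rewrite -cat_rcons.
Qed.

Definition min_edits w w' : nat := ex_minn (edit_path_exists w w').

End EditDistance.

Section Coding.
Context {R : realType}.
Implicit Types (alpha beta x y : R) (N : nat).

Definition edit_dist {A : Type} (w w' : seq A) : R := (min_edits w w')%:R / 2.

(* The supremum over [W `*` W]; it is a maximum for the finite sets of words
   considered below. *)
Definition edit_diam {A : Type} (W : set (seq A)) : R :=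
  sup [set edit_dist w w' | w in W & w' in W].

(* R/Z, identified with its fundamental domain. *)
Definition torus : set R := `[0, 1[%classic.

Definition mod1 x : R := x - (Num.floor x)%:~R.

(* The letters 1 and 0 are represented by [true] and [false]. *)
Definition xi alpha beta (n : int) x : bool :=
  mod1 (x + n%:~R * alpha) \in `[0, beta[.

Definition xi_word alpha beta N x : seq bool :=
  mkseq (fun n : nat => xi alpha beta n%:Z x) N.

Definition words alpha beta N : set (seq bool) :=
  [set xi_word alpha beta N x | x in torus].

Definition dist alpha beta N x y : R :=
  edit_dist (xi_word alpha beta N x) (xi_word alpha beta N y).

Local Open Scope ereal_scope.

(* The quotient log a_N / log N, with log 0 = -oo. *)
Definition log_ratio (a : R^nat) : (\bar R)^nat :=
  fun N => lne (a N)%:E / lne N%:R%:E.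

Definition Gamma_sup alpha beta : \bar R :=
  limn_esup (log_ratio (fun N => edit_diam (words alpha beta N))).

Definition Gamma_inf alpha beta : \bar R :=
  limn_einf (log_ratio (fun N => edit_diam (words alpha beta N))).

(* [F] is equal to [c] almost everywhere on the torus squared. *)
Definition ae_const_torus2 (F : R -> R -> \bar R) (c : \bar R) : Prop :=
  {ae (@lebesgue_measure R \x @lebesgue_measure R),
    forall xy, (torus `*` torus) xy -> F xy.1 xy.2 = c}.

(* The almost everywhere value of [F]; it is unique when it exists, and
   [-oo] is returned when [F] is not almost everywhere constant.  Hence
   [ae_value F = c] with [c <> -oo] asserts in particular that [F] is almost
   everywhere constant. *)
Definition ae_value (F : R -> R -> \bar R) : \bar R :=
  xget -oo (ae_const_torus2 F).

Definition GammaL_sup alpha beta : \bar R :=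
  ae_value (fun x y => limn_esup (log_ratio (fun N => dist alpha beta N x y))).

Definition GammaL_inf alpha beta : \bar R :=
  ae_value (fun x y => limn_einf (log_ratio (fun N => dist alpha beta N x y))).

(* Solutions are pairs (p, q) with q >= 1, not necessarily coprime. *)
Definition irr_exponent alpha : \bar R :=
  ereal_sup [set m%:E | m in [set m : R |
    infinite_set [set pq : int * nat | (0 < pq.2)%N /\
      (0 < `|alpha - pq.1%:~R / pq.2%:R| < pq.2%:R `^ (- m))%R]]].

Definition golden_ratio : R := ((1 + Num.sqrt 5) / 2)%R.

End Coding.

(* Main.v *)
(** Write [t = mu(alpha) - 1], so that [t <= phi] means [t - 1 <= 1 / t].  For
    every [m] let [q] be the least denominator with [|q alpha - p| < 2^-m].
    Then [q <= 2^m], [p / q] is reduced, and [q] consecutive orbit points are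
    [1 / q]-close to a translate of the lattice [Z / q].

    Upper bound: a shift by fewer than [q] letters brings [x] within [3 / q] of
    [y], and then [O(N / q + 1)] letters differ, so the edit distance is
    [O(q + N / q)].  Choosing [m] with [2^m ~ N^(t / (t + 1))], respectively
    [N = q^2], gives both upper exponents.

    Lower bound: cut the words into blocks of length [q].  A block that is
    copied without edits, with shift [k], forces [y - x + k alpha] to be close
    to [u / q] or to [(u - 1) / q] modulo 1, where [u] is the fractional part of
    [q (y - x)], depending on the phase [q (x + b q alpha)] of the block [b].  By
    Borel-Cantelli, [u] is almost surely far from 0 and 1, so both cases occur
    during each full turn of the phase, which takes about [1 / |q alpha - p|]
    letters.  Hence each turn costs either about [1 / (q |q alpha - p|)] edited
    blocks, or a change of the shift by some [j] with [|j alpha| <= 2 / q]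
    modulo 1, that is by about [q^(1 / t)] at least.  The condition [t <= phi]
    makes the second cost at least the first, up to [q^epsilon], and for
    [N >= 2^m q] the total is at least about [2^m]. *)

Require Import Defs.
From mathcomp Require Import zify ring lra measurable_realfun.
Set Implicit Arguments.
Unset Strict Implicit.
Unset Printing Implicit Defensive.
Import Order.TTheory GRing.Theory Num.Theory.

(** * Edit paths *)

Section Edits.
Context {A : Type}.
Implicit Types u v w : seq A.

Lemma edit_op_size w w' : edit_op w w' ->
  (size w <= (size w').+1 /\ size w' <= (size w).+1)%N.
Proof. by case=> u a v; rewrite !size_cat /=; lia. Qed.

Lemma edit_path_size n w w' : edit_path n w w' ->
  (size w <= size w' + n /\ size w' <= size w + n)%N.
Proof.
elim: n w => [|n IH] w /= => [->|[u /edit_op_size ? /IH ?]]; lia.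
Qed.

Lemma edit_op_cons a w w' : edit_op w w' -> edit_op (a :: w) (a :: w').
Proof.
case=> u b v; first exact: (@edit_delete _ (a :: u)).
exact: (@edit_insert _ (a :: u)).
Qed.

(** The position of the operation is found by peeling letters off [u] and off the prefix before the
    operation simultaneously; an insertion exactly at the boundary is attributed to [v]. *)
Lemma edit_op_cat_split u v w : edit_op (u ++ v) w ->
  (exists2 u', edit_op u u' & w = u' ++ v) \/
  (exists2 v', edit_op v v' & w = u ++ v').
Proof.
move E: (u ++ v) => s op; case: op E => {s w} x a y.
- elim: u x => [|b u IH] [|c x] /=.
  + by move=> ->; right; exists y => //; exact: (@edit_delete _ [::]).
  + by move=> ->; right; exists (c :: x ++ y) => //; exact: (@edit_delete _ (c :: x)).
  + case=> -> <-; left; exists u => //; exact: (@edit_delete _ [::]).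
  + case=> -> /IH [[u' op ->]|[v' op ->]]; [left|right].
      exists (c :: u') => //.
      exact: edit_op_cons.
    by exists v'.
- elim: u x => [|b u IH] [|c x] /=.
  + by move=> ->; right; exists (a :: y) => //; exact: (@edit_insert _ [::]).
  + move=> ->; right; exists (c :: x ++ a :: y) => //.
    exact: (@edit_insert _ (c :: x)).
  + move=> <-; left; exists (a :: b :: u) => //; exact: (@edit_insert _ [::]).
  + case=> -> /IH [[u' op ->]|[v' op ->]]; [left|right].
      exists (c :: u') => //.
      exact: edit_op_cons.
    by exists v'.
Qed.

Lemma edit_path_cat_split n u v w : edit_path n (u ++ v) w ->
  exists u' v' n1 n2, [/\ w = u' ++ v', edit_path n1 u u', edit_path n2 v v'
    & n = (n1 + n2)%N].
Proof.
elim: n u v => [|n IH] u v /=.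
  by move=> <-; exists u, v, 0%N, 0%N.
move=> [s /edit_op_cat_split[[u' op ->]|[v' op ->]] /IH].
  move=> [u1 [v1 [n1 [n2 [-> p1 p2 ->]]]]].
  by exists u1, v1, n1.+1, n2; split => //; exists u'.
move=> [u1 [v1 [n1 [n2 [-> p1 p2 ->]]]]].
exists u1, v1, n1, n2.+1; split => //; last by rewrite addnS.
by exists v'.
Qed.

Lemma min_edits_le n w w' : edit_path n w w' -> (min_edits w w' <= n)%N.
Proof.
by rewrite /min_edits; case: ex_minnP => k _ h p; apply: h; apply/asboolP.
Qed.

Lemma min_edits_path w w' : edit_path (min_edits w w') w w'.
Proof. by rewrite /min_edits; case: ex_minnP => k /asboolP. Qed.

(* The word [w] is cut into blocks of length [q]; block [b] of [w] is turned
   into the part of [w'] that starts at [s b], with [c b] operations. *)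
Lemma edit_path_blocks q B n w w' : edit_path n w w' -> (B * q <= size w)%N ->
  exists (s c : nat -> nat), [/\ s 0 = 0,
    forall b, (b < B -> s b.+1 <= s b + q + c b /\ s b + q <= s b.+1 + c b)%N,
    (\sum_(0 <= b < B) c b <= n)%N
  & forall b j x0, (b < B)%N -> c b = 0%N -> (j < q)%N ->
      (s b + j < size w')%N /\ nth x0 w (b * q + j) = nth x0 w' (s b + j)].
Proof.
elim: B n w w' => [|B IH] n w w' path hB.
  by exists (fun=> 0%N), (fun=> 0%N); split=> //; rewrite big_geq.
have hq : (q <= size w)%N by apply: leq_trans hB; rewrite mulSn leq_addr.
move: path; rewrite -{1}(cat_take_drop q w).
move=> /edit_path_cat_split [u' [v' [n1 [n2 [-> p1 p2 ->]]]]].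
have [|s [c [s0 hs hc hn]]] := IH _ _ _ p2.
  by rewrite size_drop leq_subRL // -mulSn.
(* The image [u'] of the first block moves all later starting points by its size, which differs from
   [q] by at most the [n1] operations spent on it. *)
exists (fun b => if b is b'.+1 then size u' + s b' else 0)%N.
exists (fun b => if b is b'.+1 then c b' else n1)%N; split => //.
- move=> [_|b /hs ]; last by lia.
  by rewrite s0; have := edit_path_size p1; rewrite size_takel //; lia.
- rewrite big_nat_recl //=; lia.
- move=> [|b] j x0 hb.
    move=> n10; move: p1; rewrite n10 /= => <- jq.
    rewrite size_cat mul0n !add0n nth_cat size_takel // jq nth_take //.
    by split => //; lia.
  move=> c0 jq; have [lt eqn] := hn b j x0 hb c0 jq.
  rewrite size_cat; split; first by lia.
  rewrite nth_cat -addnA ltnNge leq_addr /= addKn -eqn nth_drop.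
  by rewrite mulSn addnA.
Qed.

Lemma edit_path_trans m n u v w :
  edit_path m u v -> edit_path n v w -> edit_path (m + n) u w.
Proof.
elim: m u => [|m IH] u /= => [->//|[z op /IH h] /h p]; by exists z.
Qed.

Lemma edit_path_cons n a w w' : edit_path n w w' -> edit_path n (a :: w) (a :: w').
Proof.
elim: n w => [|n IH] w /= => [->//|[u op /IH p]]; exists (a :: u) => //.
exact: edit_op_cons.
Qed.

Lemma edit_path_delete u w : edit_path (size u) (u ++ w) w.
Proof.
by elim: u => //= a u IH; exists (u ++ w) => //; exact: (@edit_delete _ [::]).
Qed.

Lemma edit_path_insert u w : edit_path (size u) w (w ++ u).
Proof.
elim: u w => [|a u IH] w /=; first by rewrite cats0.
exists (rcons w a); first by rewrite -cats1 -{1}(cats0 w); exact: edit_insert.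
by rewrite -cat_rcons; exact: IH.
Qed.

End Edits.

(** A mismatch is repaired by one deletion and one insertion, whence the factor 2. *)
Lemma edit_path_hamming (A : eqType) (x0 : A) (w w' : seq A) :
  size w = size w' ->
  edit_path (2 * \sum_(0 <= i < size w) (nth x0 w i != nth x0 w' i)) w w'.
Proof.
elim: w w' => [|a w IH] [|b w'] //= => [_|[/IH p]].
  by rewrite big_geq.
rewrite big_nat_recl //=.
have [<-|ne] := eqVneq a b; first by rewrite add0n; exact: edit_path_cons.
rewrite mulnDr /=.
exists w; first exact: (@edit_delete _ [::]).
exists (b :: w); first exact: (@edit_insert _ [::]).
exact: edit_path_cons.
Qed.

(* Delete the first [k] letters, correct the mismatches, append [k] letters. *)
Lemma min_edits_shift (A : eqType) (x0 : A) (w w' : seq A) k :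
  size w = size w' ->
  (min_edits w w' <=
   2 * k + 2 * \sum_(0 <= i < size w - k) (nth x0 w (k + i) != nth x0 w' i))%N.
Proof.
move=> sz.
(* If [k] exceeds the length, deleting all of [w] and inserting all of [w'] is cheap enough. *)
have [kw|wk] := leqP k (size w); last first.
  apply: (@leq_trans (size w + size w')); last by lia.
  apply: min_edits_le; apply: (@edit_path_trans _ _ _ _ [::]).
    by rewrite -{2}(cats0 w); exact: edit_path_delete.
  exact: (edit_path_insert w' [::]).
apply: min_edits_le.
set S := \sum_(_ <= _ < _) _.
have -> : (2 * k + 2 * S = k + (2 * S + k))%N by lia.
apply: (@edit_path_trans _ _ _ _ (drop k w)).
  have := edit_path_delete (take k w) (drop k w).
  by rewrite cat_take_drop size_takel.
apply: (@edit_path_trans _ _ _ _ (take (size w - k) w')).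
  have := @edit_path_hamming _ x0 (drop k w) (take (size w - k) w').
  rewrite size_drop size_takel; last by rewrite -sz leq_subr.
  move=> /(_ erefl); congr (edit_path (2 * _)%N _ _).
  by apply: eq_big_nat => i /andP[_ hi]; rewrite nth_drop nth_take.
have := edit_path_insert (drop (size w - k) w') (take (size w - k) w').
by rewrite cat_take_drop size_drop -sz subKn.
Qed.

(** * Rational approximation of the rotation *)

Local Open Scope ring_scope.

Section Mod1.
Context {R : realType}.
Implicit Types x y z d : R.

Lemma mod1_ge0 x : 0 <= mod1 x.
Proof. by rewrite subr_ge0; have /andP[] := floor_itv x. Qed.

Lemma mod1_lt1 x : mod1 x < 1.
Proof.
by rewrite /mod1; have /andP[_] := floor_itv x; rewrite intrD; lra.
Qed.

Lemma mod1_unique x (n : int) : 0 <= x - n%:~R < 1 -> mod1 x = x - n%:~R.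
Proof.
move=> h; rewrite /mod1; congr (x - _%:~R); apply: floor_def.
by rewrite intrD; lra.
Qed.

Lemma mod1Dz x (n : int) : mod1 (x + n%:~R) = mod1 x.
Proof.
have h0 := mod1_ge0 x; have h1 := mod1_lt1 x.
rewrite (@mod1_unique _ (Num.floor x + n)) intrD; rewrite /mod1 in h0 h1 *; lra.
Qed.

Lemma mod1_split x : exists n : int, x = mod1 x + n%:~R.
Proof. by exists (Num.floor x); rewrite subrK. Qed.

Lemma mod1_id x : 0 <= x < 1 -> mod1 x = x.
Proof. by move=> h; rewrite (@mod1_unique _ 0) subr0. Qed.

Lemma mod1D_lt z d : 0 <= d -> mod1 z + d < 1 -> mod1 (z + d) = mod1 z + d.
Proof.
move=> d0 lt1; have [n {1}->] := mod1_split z.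
rewrite addrAC mod1Dz mod1_id // lt1 andbT.
by rewrite addr_ge0 // mod1_ge0.
Qed.

Lemma mod1D_ge z d : d < 1 -> 1 <= mod1 z + d -> mod1 (z + d) = mod1 z + d - 1.
Proof.
move=> d0 ge1; have [n {1}->] := mod1_split z.
rewrite addrAC mod1Dz (@mod1_unique _ 1) //.
by have := mod1_lt1 z; lra.
Qed.

End Mod1.

(** * How the coding detects a translation *)

Section Mismatch.
Context {R : realType}.
Implicit Types beta z d : R.

(** The translation carries [[1 - d, 1)], which lies outside [[0, beta)], across 0 into [[0, d)],
    which lies inside. *)
Lemma mismatch_left beta z d : d <= beta -> d <= 1 - beta -> 1 - d <= mod1 z ->
  (mod1 z < beta) != (mod1 (z + d) < beta).
Proof.
move=> db db' h; have z1 := mod1_lt1 z.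
rewrite mod1D_ge; [|lra..].
have -> : (mod1 z < beta) = false by lra.
by have -> : (mod1 z + d - 1 < beta) = true by lra.
Qed.

(** Adding [d] amounts to moving left by [1 - d], which carries [[0, 1 - d)] across 0 to the end of
    the circle. *)
Lemma mismatch_right beta z d : 1 - d <= beta -> 1 - d <= 1 - beta ->
  mod1 z < 1 - d -> (mod1 z < beta) != (mod1 (z + d) < beta).
Proof.
move=> db db' h; have z0 := mod1_ge0 z.
rewrite mod1D_lt; [|lra..].
have -> : (mod1 z < beta) = true by lra.
by have -> : (mod1 z + d < beta) = false by lra.
Qed.

(** The witness is adjacent to [1 - d], the point carried to 0: the interval on its right lands in
    [[0, c)], the one on its left in [[1 - c, 1)]. The letter at [1 - d] decides which of them gives
    a mismatch. *)
Lemma mismatch_interval beta c d : 0 <= c -> c <= d -> c <= 1 - d -> c <= beta ->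
  c <= 1 - beta -> exists A, [/\ 0 <= A, A + c <= 1 & forall z,
    A <= mod1 z < A + c -> (mod1 z < beta) != (mod1 (z + d) < beta)].
Proof.
move=> c0 cd cd' cb cb'; have [db|db] := leP d (1 - beta).
  exists (1 - d); split; [lra..|move=> z h].
  have z1 := mod1_lt1 z; have -> : (mod1 z < beta) = false by lra.
  rewrite mod1D_ge; [|lra..].
  by have -> : (mod1 z + d - 1 < beta) = true by lra.
exists (1 - d - c); split; [lra..|move=> z h].
have -> : (mod1 z < beta) = true by lra.
rewrite mod1D_lt; [|lra..].
by have -> : (mod1 z + d < beta) = false by lra.
Qed.

End Mismatch.

(** * Best approximations and the visits of the orbit *)

Section Approximation.
Context {R : realType}.
Variable a : R.
Implicit Types (q j k m : nat) (p n r : int) (x X A u : R).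

(** Pigeonhole: two of the [Q + 1] points [i a] modulo 1 fall into the same of [Q] boxes of length
    [1 / Q]. *)
Lemma dirichlet Q : (0 < Q)%N ->
  exists q p, [/\ (0 < q)%N, (q <= Q)%N & `|q%:R * a - p%:~R| < Q%:R^-1].
Proof.
move=> Q0; have Q0' : 0 < Q%:R :> R by rewrite ltr0n.
have trb (i : 'I_Q.+1) : (Num.truncn (Q%:R * mod1 (i%:R * a)) < Q)%N.
  have h0 : 0 <= Q%:R * mod1 (i%:R * a) by rewrite mulr_ge0 ?mod1_ge0 ?ltW.
  rewrite -(ltr_nat R); have /andP[h _] := truncn_itv h0.
  apply: le_lt_trans h _.
  by rewrite -[ltRHS]mulr1 ltr_pM2l // mod1_lt1.
pose f (i : 'I_Q.+1) : 'I_Q := Ordinal (trb i).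
have : ~~ injectiveb f.
  apply/negP => /injectiveP /leq_card; by rewrite !card_ord ltnn.
move=> /injectivePn[i [j ij fij]].
wlog lt_ij : i j ij fij / (i < j)%N.
  move=> H; have [h|h|h] := ltngtP i j; first exact: (H i j).
    by apply: (H j i) => //; rewrite eq_sym.
  by move: ij; rewrite (val_inj h) eqxx.
have [ni Ei] := mod1_split (i%:R * a); have [nj Ej] := mod1_split (j%:R * a).
exists (j - i)%N, (nj - ni)%R.
split; [by rewrite subn_gt0|by have := ltn_ord j; lia|].
have -> : (j - i)%N%:R * a - (nj - ni)%:~R
   = mod1 (j%:R * a) - mod1 (i%:R * a).
  by rewrite (natrB _ (ltnW lt_ij)) intrB mulrBl {1}Ei {1}Ej; lra.
rewrite -(ltr_pM2l Q0') mulfV ?gt_eqF // -{1}[Q%:R]gtr0_norm // -normrM mulrBr.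
have := congr1 val fij => /=.
have hi : 0 <= Q%:R * mod1 (i%:R * a) by rewrite mulr_ge0 ?mod1_ge0 ?ltW.
have hj : 0 <= Q%:R * mod1 (j%:R * a) by rewrite mulr_ge0 ?mod1_ge0 ?ltW.
have /andP[i1 i2] := truncn_itv hi; have /andP[j1 j2] := truncn_itv hj.
move=> e; rewrite e in i1 i2.
rewrite -natr1 in i2; rewrite -natr1 in j2.
rewrite ltr_norml; apply/andP; split; lra.
Qed.

(** No smaller denominator does as well, so [q] is the denominator of a best approximation; dyadic
    thresholds take the place of the continued fraction expansion. *)
Definition least_denom m q p :=
  [/\ (0 < q)%N, `|q%:R * a - p%:~R| < 2^-1 ^+ m
    & forall q' p', (0 < q')%N -> `|q'%:R * a - p'%:~R| < 2^-1 ^+ m ->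
      (q <= q')%N].

Lemma least_denom_exists m : exists q p, least_denom m q p.
Proof.
pose P q := `[< (0 < q)%N /\ exists p : int, `|q%:R * a - p%:~R| < 2^-1 ^+ m >].
have exP : exists q, P q.
  have [|q [p [q0 _ h]]] := @dirichlet (2 ^ m); first by rewrite expn_gt0.
  exists q; apply/asboolP; split => //; exists p.
  by rewrite natrX -exprVn in h.
case: (ex_minnP exP) => q /asboolP[q0 [p hp]] hq.
exists q, p; split => // q' p' q'0 h; apply: hq; apply/asboolP; split => //.
by exists p'.
Qed.

Lemma least_denom_le m q p : least_denom m q p -> (q <= 2 ^ m)%N.
Proof.
move=> [_ _ h]; have [|q' [p' [q0 qQ hq]]] := @dirichlet (2 ^ m).
  by rewrite expn_gt0.
apply: leq_trans qQ; apply: (h _ p') => //.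
by rewrite natrX -exprVn in hq.
Qed.

(** Cancelling a common factor [d] divides both the denominator and the error by [d], so minimality
    forces [d = 1]. *)
Lemma least_denom_coprime m q p : least_denom m q p -> coprime `|p| q.
Proof.
move=> [q0 hp hq]; set d := gcdn `|p| q.
have d0 : (0 < d)%N by rewrite gcdn_gt0 q0 orbT.
have /dvdnP[q1 q1E] : (d %| q)%N by exact: dvdn_gcdr.
have /dvdzP[p1 p1E] : (d %| p)%Z by rewrite dvdzE; exact: dvdn_gcdl.
have d1 : 1 <= d%:R :> R by rewrite ler1n.
have : (q <= q1)%N.
  apply: (hq _ p1); first by move: q0; rewrite q1E muln_gt0 => /andP[].
  apply: le_lt_trans hp.
  have -> : q%:R * a - p%:~R = d%:R * (q1%:R * a - p1%:~R).
    by rewrite q1E p1E natrM intrM -pmulrn; ring.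
  rewrite normrM (@ger0_norm _ d%:R) //.
  by rewrite ler_peMl.
rewrite {1}q1E => h; rewrite /coprime -/d.
have q10 : (0 < q1)%N by move: q0; rewrite q1E muln_gt0 => /andP[].
by rewrite eqn_leq d0 andbT -(@leq_pmul2l q1) // muln1.
Qed.

(** This product, called [rho] below, is the amount by which the phase [q X] modulo 1 drifts over a
    block of length [q]. *)
Lemma least_denom_rho m q p : least_denom m q p ->
  q%:R * `|q%:R * a - p%:~R| < 1.
Proof.
move=> h; have := least_denom_le h; case: h => q0 hp _.
rewrite -(ler_nat R) natrX => hq.
apply: (@le_lt_trans _ _ (2 ^+ m * `|q%:R * a - p%:~R|)).
  by rewrite ler_wpM2r.
by rewrite -ltr_pdivlMl ?exprn_gt0 // mulr1 -exprVn.
Qed.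

Lemma coprime_residue p q g : (0 < q)%N -> coprime `|p| q ->
  exists j n, (j < q)%N /\ g + j%:Z * p = n * q%:Z.
Proof.
move=> q0 cpq.
have [u [v uv]] := Bezoutz p q%:Z.
have {uv} uv : u * p + v * q%:Z = 1.
  by rewrite uv /gcdz absz_nat (eqP cpq).
have q0' : q%:Z != 0 by lia.
exists `|(- g * u %% q%:Z)%Z|%N, (g * v - (- g * u %/ q%:Z)%Z * p).
have ge0 := modz_ge0 (- g * u) q0'.
split.
  by have := ltz_pmod (- g * u) (_ : 0 < q%:Z); lia.
rewrite gez0_abs //.
have E := divz_eq (- g * u) q%:Z.
have -> : (- g * u %% q%:Z)%Z = - g * u - (- g * u %/ q%:Z)%Z * q%:Z.
  by rewrite {2}E; ring.
set t := (_ %/ _)%Z.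
have -> : g * v = g * v * (u * p + v * q%:Z) by rewrite uv mulr1.
rewrite -[X in X + _]mulr1 -uv; apply/eqP; rewrite -subr_eq0; apply/eqP.
transitivity (g * (1 - (u * p + v * q%:Z)) * (v * q%:Z)); first by ring.
by rewrite uv subrr mulr0 mul0r.
Qed.

(** With [p / q] in place of [a], the [q] points run through all of [(f + Z) / q] modulo 1, where
    [f] is the fractional part of [q X]; the replacement costs [j / q] times [q a - p]. *)
Lemma orbit_hit q p X r : (0 < q)%N -> coprime `|p| q ->
  exists j n, (j < q)%N /\
    `|X + j%:R * a - n%:~R - (mod1 (q%:R * X) + r%:~R) / q%:R|
      <= `|q%:R * a - p%:~R|.
Proof.
move=> q0 cpq; have q0' : 0 < q%:R :> R by rewrite ltr0n.
have [g gE] := mod1_split (q%:R * X).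
have [j [n [jq jn]]] := coprime_residue (g - r) q0 cpq.
exists j, n; split => //.
have {}jn : (g%:~R - r%:~R + j%:R * p%:~R = n%:~R * q%:R :> R).
  by rewrite -intrB -[j%:R]/(j%:~R) -[q%:R]/(q%:~R) -!intrM -intrD jn.
have -> : X + j%:R * a - n%:~R - (mod1 (q%:R * X) + r%:~R) / q%:R
    = (j%:R / q%:R) * (q%:R * a - p%:~R).
  move: gE jn; move: (mod1 _) => f gE jn.
  have -> : X = (f + g%:~R) / q%:R by rewrite -gE mulrC mulKf ?gt_eqF.
  have -> : n%:~R = (g%:~R - r%:~R + j%:R * p%:~R) / q%:R :> R.
    by rewrite jn mulfK ?gt_eqF.
  by field; rewrite gt_eqF.
rewrite normrM ger0_norm ?divr_ge0 // ler_piMl //.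
by rewrite ler_pdivrMr // mul1r ler_nat ltnW.
Qed.

Lemma orbit_hit_itv q p X A : (0 < q)%N -> coprime `|p| q ->
  q%:R * `|q%:R * a - p%:~R| < 1 ->
  exists j n, (j < q)%N /\ A <= X + j%:R * a - n%:~R < A + 3 / q%:R.
Proof.
move=> q0 cpq rho1; have q0' : 0 < q%:R :> R by rewrite ltr0n.
set f := mod1 (q%:R * X).
(* The offset 2 puts the lattice point between [A + 1 / q] and [A + 2 / q], so an error below
   [1 / q] cannot leave the interval. *)
have [j [n [jq h]]] := orbit_hit X (Num.floor (q%:R * A - f) + 2) q0 cpq.
exists j, n; split => //; move: h rho1.
move: (_ + _ - n%:~R) => v; move: `|_ - p%:~R| => e.
rewrite -/f intrD ler_norml => /andP[h1 h2] rho1.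
have /andP[] := floor_itv (q%:R * A - f); rewrite intrD => h3 h4.
move: h1 h2 h3 h4; move: (Num.floor _)%:~R => t h1 h2 h3 h4.
have E : v = (q%:R * v) / q%:R by rewrite mulrC mulKf ?gt_eqF.
have h1' : f + (t + 2) - q%:R * e <= q%:R * v.
  have := ler_wpM2l (ltW q0') h1.
  by rewrite mulrBr [q%:R * (_ / _)]mulrC divfK ?gt_eqF // mulrN; lra.
have h2' : q%:R * v <= f + (t + 2) + q%:R * e.
  have := ler_wpM2l (ltW q0') h2.
  by rewrite mulrBr [q%:R * (_ / _)]mulrC divfK ?gt_eqF //; lra.
apply/andP; split.
  by rewrite -(ler_pM2l q0'); lra.
rewrite -(ltr_pM2l q0') mulrDr [q%:R * (_ / _)]mulrC divfK ?gt_eqF //; lra.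
Qed.

End Approximation.

(** * What equality of two blocks of length [q] implies *)

Section Block.
Context {R : realType}.
Implicit Types (a beta rho X Y u d f : R) (q j : nat) (p n r A : int).

Definition same_block a beta q X Y := forall j, (j < q)%N ->
  (mod1 (X + j%:R * a) < beta) = (mod1 (Y + j%:R * a) < beta).

Lemma same_block_shift a beta q X Y d n j : Y - X = d + n%:~R ->
  same_block a beta q X Y -> (j < q)%N ->
  (mod1 (X + j%:R * a) < beta) = (mod1 (X + j%:R * a + d) < beta).
Proof.
move=> E h jq; rewrite h // -(mod1Dz (_ + d) n).
congr (mod1 _ < _); move: E => /(canRL (subrK _)) ->; lra.
Qed.

(** Otherwise there is a mismatch interval of length [3 / q], and any [q] consecutive orbit points
    visit it. *)
Lemma same_block_near a beta q p X Y d n : (0 < q)%N -> coprime `|p| q ->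
  q%:R * `|q%:R * a - p%:~R| < 1 -> 3 / q%:R <= beta -> 3 / q%:R <= 1 - beta ->
  Y - X = d + n%:~R ->
  same_block a beta q X Y -> d < 3 / q%:R \/ 1 - d < 3 / q%:R.
Proof.
move=> q0 cpq rho1 qb qb' E h.
have [|d1] := ltP d (3 / q%:R); first by left.
have [|d2] := ltP (1 - d) (3 / q%:R); first by right.
have [|A [A0 A1 mis]] := mismatch_interval _ d1 d2 qb qb'.
  by rewrite divr_ge0 // ler0n.
have [j [m [jq /andP[h1 h2]]]] := orbit_hit_itv X A q0 cpq rho1.
have := mis (X + j%:R * a); rewrite (same_block_shift E h jq) eqxx.
rewrite (@mod1_unique _ _ m) ?h1 ?h2; last by apply/andP; split; lra.
by move=> /(_ isT).
Qed.

Lemma orbit_hit_scaled a rho q p X r : rho = q%:R * `|q%:R * a - p%:~R| ->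
  (0 < q)%N -> coprime `|p| q ->
  exists j n v, [/\ (j < q)%N, X + j%:R * a = v + n%:~R &
    mod1 (q%:R * X) + r%:~R - rho <= q%:R * v <= mod1 (q%:R * X) + r%:~R + rho].
Proof.
move=> rhoE q_gt0 cpq; have q0 : 0 < q%:R :> R by rewrite ltr0n.
have [j [n [jq]]] := orbit_hit a X r q_gt0 cpq.
move E : (X + j%:R * a - n%:~R) => v; move: rhoE.
move: (mod1 _) (`|_ - p%:~R|) => f e ->.
rewrite ler_norml => /andP[h1 h2]; exists j, n, v; split => //.
  by rewrite -E subrK.
have h1' := ler_wpM2l (ltW q0) h1; have h2' := ler_wpM2l (ltW q0) h2.
move: h1' h2'; rewrite mulrN [q%:R * (_ - _ / _)]mulrBr.
rewrite [q%:R * (_ / _)]mulrC divfK ?gt_eqF // => h1' h2'.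
by apply/andP; split; lra.
Qed.

(* [d] is the shift of the block and [f] its phase.  If [d] is small and
   positive, no orbit point may lie in the interval of length [d] to the left
   of 0; the rational rotation by [p / q] has a point near [(f - 1) / q]. *)
Lemma shift_not_right a beta rho q p X d f : rho = q%:R * `|q%:R * a - p%:~R| ->
  (0 < q)%N -> coprime `|p| q -> 3 / q%:R <= beta -> 3 / q%:R <= 1 - beta ->
  (forall j, (j < q)%N ->
    (mod1 (X + j%:R * a) < beta) = (mod1 (X + j%:R * a + d) < beta)) ->
  f = mod1 (q%:R * X) -> rho <= f -> f + rho < 1 ->
  0 <= d -> d < 3 / q%:R -> q%:R * d < 1 - f + rho.
Proof.
move=> rhoE q_gt0 cpq qb qb' same fE f_ge f_lt d0 d3.
have q0 : 0 < q%:R :> R by rewrite ltr0n.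
rewrite ltNge; apply/negP => hu.
have [j [n [v [jq vE]]]] := orbit_hit_scaled X (-1) rhoE q_gt0 cpq.
rewrite -fE mulrN1z => /andP[h1 h2].
have lt0 : v < 0.
  by rewrite -(pmulr_rlt0 _ q0); apply: le_lt_trans h2 _; move: f_lt; clear; lra.
have ged : - d <= v.
  rewrite -(ler_pM2l q0) mulrN; apply: le_trans h1; move: hu; clear; lra.
have modE : mod1 (X + j%:R * a) = v + 1.
  have E : X + j%:R * a - (n - 1)%:~R = v + 1 by rewrite vE intrB; lra.
  by rewrite (@mod1_unique _ _ (n - 1)) E //; apply/andP; split; lra.
have := mismatch_left (z := X + j%:R * a) (d := d) (beta := beta).
rewrite -same // eqxx modE.
by move=> H; have : false by apply: H; lra.
Qed.

(** Mirror image of the preceding case: for a move to the left by [1 - d], the orbit point near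
    [f / q] must not lie in [[0, 1 - d)]. *)
Lemma shift_not_left a beta rho q p X d f : rho = q%:R * `|q%:R * a - p%:~R| ->
  (0 < q)%N -> coprime `|p| q -> 3 / q%:R <= beta -> 3 / q%:R <= 1 - beta ->
  (forall j, (j < q)%N ->
    (mod1 (X + j%:R * a) < beta) = (mod1 (X + j%:R * a + d) < beta)) ->
  f = mod1 (q%:R * X) -> rho <= f -> f + rho < 1 ->
  0 <= d -> 1 - d < 3 / q%:R -> q%:R * (1 - d) <= f + rho.
Proof.
move=> rhoE q_gt0 cpq qb qb' same fE f_ge f_lt d0 d3.
have q0 : 0 < q%:R :> R by rewrite ltr0n.
rewrite leNgt; apply/negP => hu.
have [j [n [v [jq vE]]]] := orbit_hit_scaled X 0 rhoE q_gt0 cpq.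
rewrite -fE addr0 => /andP[h1 h2].
have ge0 : 0 <= v.
  by rewrite -(pmulr_rge0 _ q0); apply: le_trans h1; move: f_ge; clear; lra.
have ltd : v < 1 - d.
  by rewrite -(ltr_pM2l q0); apply: le_lt_trans h2 hu.
have modE : mod1 (X + j%:R * a) = v.
  have E : X + j%:R * a - n%:~R = v by rewrite vE addrK.
  by rewrite (@mod1_unique _ _ n) E //; apply/andP; split; lra.
have := mismatch_right (z := X + j%:R * a) (d := d) (beta := beta).
rewrite -same // eqxx modE.
by move=> H; have : false by apply: H; lra.
Qed.

(** Modulo 1 the shift is [(u + A) / q] with an integer [A] in [[0, q)]. The two preceding bounds
    leave only [A = 0] and [A = q - 1], and the phase [f] rules out one of these. *)
Lemma same_block_cases a beta rho q p X Y u f (N : int) :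
  rho = q%:R * `|q%:R * a - p%:~R| -> rho < 1 ->
  (0 < q)%N -> coprime `|p| q -> 3 / q%:R <= beta -> 3 / q%:R <= 1 - beta ->
  f = mod1 (q%:R * X) -> rho <= f -> f + rho < 1 ->
  0 < u -> u < 1 -> q%:R * (Y - X) = u + N%:~R -> same_block a beta q X Y ->
  (f + rho < 1 - u -> exists n : int, Y - X = u / q%:R + n%:~R) /\
  (1 - u <= f - rho -> exists n : int, Y - X = (u - 1) / q%:R + n%:~R).
Proof.
move=> rhoE rho1 q_gt0 cpq qb qb' fE f_ge f_lt u0 u1 phase same.
have q0 : 0 < q%:R :> R by rewrite ltr0n.
have [A AE] : exists A, A = (N %% q%:Z)%Z by eexists.
have [n0 n0E] : exists n0, n0 = (N %/ q%:Z)%Z by eexists.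
have NE : N%:~R = n0%:~R * q%:R + A%:~R :> R.
  by rewrite {1}(divz_eq N q%:Z) intrD intrM -n0E -AE.
have A_ge0 : 0 <= A by rewrite AE modz_ge0 // eqz_nat -lt0n.
have A_lt : A < q%:Z by rewrite AE ltz_pmod // ltz_nat.
have [d dE] : exists d, d = (u + A%:~R) / q%:R by eexists.
have qd : q%:R * d = u + A%:~R by rewrite dE mulrC divfK ?gt_eqF.
have YX : Y - X = d + n0%:~R.
  have -> : Y - X = (u + N%:~R) / q%:R by rewrite -phase mulrC mulKf ?gt_eqF.
  by rewrite NE dE; field; rewrite gt_eqF.
have near : d < 3 / q%:R \/ 1 - d < 3 / q%:R.
  by apply: (same_block_near q_gt0 cpq _ qb qb' YX same); rewrite -rhoE.
have shift := same_block_shift YX same.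
have A_ge0' : 0 <= A%:~R :> R by rewrite ler0z.
have A_lt' : A%:~R <= q%:R - 1 :> R.
  by rewrite lerBrDr -[1]/(1%:~R) -intrD -[q%:R]/(q%:~R) ler_int lezD1.
have d0 : 0 <= d by rewrite dE divr_ge0 ?ler0n // addr_ge0 // ltW.
have nr := shift_not_right rhoE q_gt0 cpq qb qb' (fun j => shift j) fE f_ge f_lt d0.
have nl := shift_not_left rhoE q_gt0 cpq qb qb' (fun j => shift j) fE f_ge f_lt d0.
rewrite mulrBr mulr1 qd in nl; rewrite qd in nr.
clear shift phase NE fE rhoE AE n0E.
split=> fu.
  exists n0; rewrite YX dE; congr (_ / _ + _).
  have : A%:~R < 1%:~R :> R by case: near => [/nr|/nl] h; rewrite /=; lra.
  rewrite ltr_int => A1; have -> : A = 0 by move: A_ge0 A1; clear; lia.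
  by rewrite addr0.
exists (n0 + 1); rewrite YX dE.
have : q%:R - 2 < A%:~R :> R by case: near => [/nr|/nl] h; lra.
rewrite -[2]/(2%:~R) -[q%:R]/(q%:~R) -intrB ltr_int => A1.
have -> : A = q%:Z - 1 by move: A_lt A1; clear; lia.
by rewrite intrB intrD -[q%:~R]/(q%:R); field; rewrite gt_eqF.
Qed.

End Block.

(** * Lower bound for the number of edits *)

(** The phase reaches the next translate of [A] within one turn, overshoots it by at most
    [rho <= e], and drifts by at most [e] more during [G] blocks. *)
Lemma phase_window_pos (R : realType) (e rho c A : R) (b0 G W : nat) :
  0 < rho -> rho <= e -> e <= 2^-1 -> G%:R * rho <= e -> 2 <= W%:R * rho ->
  exists b1, [/\ (b0 <= b1)%N, (b1 + G <= b0 + W)%N & forall b,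
    (b1 <= b < b1 + G)%N -> exists n : int, A <= c + b%:R * rho - n%:~R <= A + 2 * e].
Proof.
move=> rho0 rhoe e2 Ge W2.
pose t0 : R := c + b0%:R * rho.
pose n := Num.floor (t0 - A) + 1.
have [D De] : exists D, D = A + n%:~R - t0 by eexists.
have /andP[f1 f2] := floor_itv (t0 - A).
have nE : n%:~R = (Num.floor (t0 - A))%:~R + 1 :> R by rewrite intrD.
rewrite intrD in f2.
have D0 : 0 < D by rewrite De nE; lra.
have D1 : D <= 1 by rewrite De nE; lra.
have q0 : 0 <= D / rho by rewrite divr_ge0 // ltW.
have /andP[k1 k2] := truncn_itv q0.
set k := (Num.truncn (D / rho)).+1 in k2.
rewrite ler_pdivlMr // in k1; rewrite ltr_pdivrMr // in k2.
have kE : k%:R = (Num.truncn (D / rho))%:R + 1 :> R by rewrite natr1.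
exists (b0 + k)%N; split; first exact: leq_addr.
  rewrite -addnA leq_add2l -(ler_nat R) natrD -(ler_pM2r rho0) mulrDl kE; lra.
move=> b /andP[b1 b2]; exists n.
have b1' : b0%:R * rho + k%:R * rho <= b%:R * rho.
  by rewrite -mulrDl -natrD ler_pM2r // ler_nat.
have b2' : b%:R * rho <= b0%:R * rho + k%:R * rho + G%:R * rho.
  by rewrite -!mulrDl -!natrD ler_pM2r // ler_nat ltnW.
rewrite kE in k2 b1' b2'; rewrite mulrDl mul1r in b2' b1' k2.
have D' : D = A + n%:~R - (c + b0%:R * rho) by [].
by apply/andP; split; lra.
Qed.

(** A negative drift becomes positive after reflection, which turns the target into
    [[- A - 2 e, - A]]. *)
Lemma phase_window (R : realType) (e rho c A : R) (b0 G W : nat) :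
  0 < `|rho| -> `|rho| <= e -> e <= 2^-1 -> G%:R * `|rho| <= e ->
  2 <= W%:R * `|rho| ->
  exists b1, [/\ (b0 <= b1)%N, (b1 + G <= b0 + W)%N & forall b,
    (b1 <= b < b1 + G)%N -> exists n : int, A <= c + b%:R * rho - n%:~R <= A + 2 * e].
Proof.
have [rho0|rho0] := ltP 0 rho.
  by rewrite gtr0_norm //; exact: phase_window_pos.
rewrite ler0_norm // => h1 h2 h3 h4 h5.
have [b1 [l1 l2 hb]] := phase_window_pos (- c) (- A - 2 * e) b0 h1 h2 h3 h4 h5.
exists b1; split => // b /hb [n hn]; exists (- n).
rewrite mulrN in hn; rewrite intrN; move: hn.
by move: (b%:R * rho) => z /andP[z1 z2]; apply/andP; split; lra.
Qed.

(** * Counting edits and changes of shift *)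

Section Cost.
Implicit Types (c s : nat -> nat) (k : nat -> int).

Lemma sum_shift_le c k B : (forall b, (b < B)%N -> `|k b.+1 - k b| <= (c b)%:Z) ->
  forall b b', (b <= b' <= B)%N -> `|k b' - k b| <= (\sum_(b <= i < b') c i)%N%:Z.
Proof.
move=> h b; elim=> [|b' IH] /andP[bb' b'B].
  have -> : b = 0%N by lia.
  by rewrite subrr normr0.
have [e|lt] := eqVneq b b'.+1; first by rewrite e subrr normr0 big_geq.
rewrite big_nat_recr /=; last by lia.
have := IH; have := h b'; lia.
Qed.

Lemma sum_nat_mono c b b' d d' : (d <= b)%N -> (b' <= d')%N ->
  (\sum_(b <= i < b') c i <= \sum_(d <= i < d') c i)%N.
Proof.
move=> db bd; have [bb'|bb'] := leqP b b'; last by rewrite big_geq // ltnW.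
rewrite (@big_cat_nat _ _ _ b d d') //=; last by lia.
rewrite (@big_cat_nat _ _ _ b' b d') //=; lia.
Qed.

Lemma zero_or_sum_ge c b G :
  (exists2 i, (b <= i < b + G)%N & c i = 0%N) \/
  (G <= \sum_(b <= i < b + G) c i)%N.
Proof.
elim: G => [|G [[i hi ci]|IH]]; first by right.
  by left; exists i => //; lia.
have [c0|c0] := posnP (c (b + G)%N); first by left; exists (b + G)%N => //; lia.
by right; rewrite addnS big_nat_recr ?leq_addr //=; lia.
Qed.

(** Either one of the two groups of [G] blocks is edited throughout, at cost at least [G], or both
    contain a copied block, and passing from one shift to the other costs at least [K]. *)
Lemma window_cost c k B b0 W b1 b2 G K :
  (forall b, (b < B)%N -> `|k b.+1 - k b| <= (c b)%:Z) ->
  (b0 + W <= B)%N -> (b0 <= b1)%N -> (b1 + G <= b0 + W)%N ->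
  (b0 <= b2)%N -> (b2 + G <= b0 + W)%N ->
  (forall b b', (b1 <= b < b1 + G)%N -> (b2 <= b' < b2 + G)%N ->
     c b = 0%N -> c b' = 0%N -> K%:Z <= `|k b - k b'|) ->
  (minn G K <= \sum_(b0 <= i < b0 + W) c i)%N.
Proof.
move=> hk hB l1 r1 l2 r2 h; rewrite geq_min.
have [[i hi ci]|h1] := zero_or_sum_ge c b1 G; last first.
  by apply/orP; left; apply: leq_trans h1 _; exact: sum_nat_mono.
have [[j hj cj]|h2] := zero_or_sum_ge c b2 G; last first.
  by apply/orP; left; apply: leq_trans h2 _; exact: sum_nat_mono.
apply/orP; right; have := h i j hi hj ci cj.
have [ij|ji] := leqP i j.
  have := sum_shift_le hk (_ : i <= j <= B)%N.
  have := @sum_nat_mono c i j b0 (b0 + W); lia.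
have := sum_shift_le hk (_ : j <= i <= B)%N.
have := @sum_nat_mono c j i b0 (b0 + W); lia.
Qed.

Lemma windows_sum c W V m :
  (forall v, (v < V)%N -> (m <= \sum_(v * W <= i < v * W + W) c i)%N) ->
  (V * m <= \sum_(0 <= i < V * W) c i)%N.
Proof.
elim: V => [|V IH] h; first by [].
rewrite (@big_cat_nat _ _ _ (V * W)) //=; last by lia.
rewrite mulSn addnC; apply: leq_add; first by apply: IH => v hv; apply: h; lia.
by have := h V (ltnSn V); rewrite mulSn addnC.
Qed.

End Cost.

Section Lower.
Context {R : realType}.
Implicit Types (a beta x y e u : R) (q N B : nat) (p n : int).

Lemma xi_mod1 a beta n x : xi a beta n x = (mod1 (x + n%:~R * a) < beta).
Proof. by rewrite /xi in_itv /= mod1_ge0. Qed.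

(* The shift of block [b] is [k b]; blocks with [c b = 0] are copied without
   edits. *)
Lemma edits_blocks a beta q N B x y : (B * q <= N)%N ->
  exists (c : nat -> nat) (k : nat -> int),
  let E := min_edits (xi_word a beta N x) (xi_word a beta N y) in
  [/\ (\sum_(0 <= b < B) c b <= E)%N,
    (forall b, (b < B)%N -> `|k b.+1 - k b| <= (c b)%:Z),
    (forall b, (b <= B)%N -> `|k b| <= E%:Z)
  & forall b, (b < B)%N -> c b = 0%N ->
      same_block a beta q (x + (b * q)%:R * a)
        (y + (b * q)%:R * a + (k b)%:~R * a)].
Proof.
move=> hB; set w := xi_word a beta N x; set w' := xi_word a beta N y.
have [|s [c [s0 hs hc hn]]] := @edit_path_blocks _ q B _ _ _ (min_edits_path w w').
  by rewrite size_mkseq.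
pose k b := (s b)%:Z - (b * q)%:Z.
have hk b : (b < B)%N -> `|k b.+1 - k b| <= (c b)%:Z.
  by move=> /hs; rewrite /k; lia.
exists c, k; split => //.
  move=> b bB; have := sum_shift_le hk (_ : 0 <= b <= B)%N.
  have -> : k 0%N = 0 by rewrite /k s0.
  rewrite subr0 => /(_ bB) /le_trans; apply.
  by rewrite lez_nat (leq_trans _ hc) // sum_nat_mono.
move=> b bB c0 j jq.
have [lt] := hn b j false bB c0 jq.
rewrite size_mkseq in lt.
have lt' : (b * q + j < N)%N.
  apply: leq_trans hB; apply: (@leq_trans (b.+1 * q)).
    by rewrite mulSn addnC ltn_add2r.
  by rewrite leq_mul2r bB orbT.
rewrite !nth_mkseq // !xi_mod1 => H.
have kE : (k b)%:~R = (s b)%:R - (b * q)%:R :> R by rewrite /k intrB.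
have -> : x + (b * q)%:R * a + j%:R * a = x + (b * q + j)%N%:~R * a.
  by rewrite -[_%:~R]/((b * q + j)%:R) natrD mulrDl addrA.
rewrite H; congr (mod1 _ < _).
by rewrite kE -[_%:~R]/((s b + j)%:R) natrD; ring.
Qed.

(* Copied blocks whose phase lies in [2e, 4e] have shifts of one type, those with
   phase in [1 - 4e, 1 - 2e] of the other, and shifts of different type differ by
   at least [K].  The hypotheses on [G] and [W] say that [W] consecutive blocks
   contain [G] consecutive blocks of either phase. *)
Lemma edits_lower a beta q p x y N B rho e u (N0 : int) G W V K :
  let E := min_edits (xi_word a beta N x) (xi_word a beta N y) in
  beta < 1 -> (0 < q)%N -> coprime `|p| q ->
  3 / q%:R <= beta -> 3 / q%:R <= 1 - beta ->
  rho = q%:R * `|q%:R * a - p%:~R| -> 0 < rho -> rho <= e ->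
  q%:R * (y - x) = u + N0%:~R -> 8 * e <= u -> u <= 1 - 8 * e ->
  E%:R * `|q%:R * a - p%:~R| <= e ->
  G%:R * rho <= e -> 2 <= W%:R * rho ->
  (forall j n : int, j != 0 -> `|j%:~R * a - n%:~R| <= 2 / q%:R -> K%:Z <= `|j|) ->
  (B * q <= N)%N -> (V * W <= B)%N -> (V * minn G K <= E)%N.
Proof.
move=> E beta1 q_gt0 cpq qb qb' rhoE rho0 rhoe phase u8 u8' Ee Ge W2 hK hB hV.
have q0 : 0 < q%:R :> R by rewrite ltr0n.
have q3 : 1 / q%:R < 1 :> R.
  rewrite ltr_pdivrMr // mul1r.
  have : 3 / q%:R <= 1 :> R by apply: le_trans qb (ltW beta1).
  by rewrite ler_pdivrMr //; lra.
have e0 : 0 < e by lra.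
have e16 : 16 * e <= 1 by lra.
have [c [k [hc hk kE hs]]] := @edits_blocks a beta q N B x y hB.
apply: leq_trans hc; apply: leq_trans (sum_nat_mono c (leqnn 0) hV).
apply: windows_sum => v vV.
have hB' : (v * W + W <= B)%N.
  by apply: leq_trans hV; rewrite addnC -mulSn leq_mul2r vV orbT.
have [t tE] : exists t, t = q%:R * a - p%:~R by eexists.
pose r : R := q%:R * t.
have nr : `|r| = rho by rewrite /r normrM ger0_norm ?ler0n // tE rhoE.
have e2 : e <= 2^-1 by lra.
rewrite -nr in Ge W2.
have [||b1 [l1 r1 hb1]] := phase_window (q%:R * x) (2 * e) (v * W) _ _ e2 Ge W2.
- by rewrite nr.
- by rewrite nr.
have [||b2 [l2 r2 hb2]] := phase_window (q%:R * x) (1 - 4 * e) (v * W) _ _ e2 Ge W2.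
- by rewrite nr.
- by rewrite nr.
apply: (window_cost hk hB' l1 r1 l2 r2) => b b' hb hb' cb cb'.
have bB : (b < B)%N by move: hb r1 hB'; clear; lia.
have bB' : (b' < B)%N by move: hb' r2 hB'; clear; lia.
(* Since [i q p] is an integer, the phase of block [i] is [q x + i r] modulo 1. *)
have phaseE A i n : 0 <= A -> A + 2 * e < 1 ->
    A <= q%:R * x + i%:R * r - n%:~R <= A + 2 * e ->
    A <= mod1 (q%:R * (x + (i * q)%:R * a)) <= A + 2 * e.
  move=> A0 A1 hA; have -> : q%:R * (x + (i * q)%:R * a) =
      q%:R * x + i%:R * r + (i%:Z * q%:Z * p)%:~R.
    by rewrite !intrM -!pmulrn natrM /r tE; ring.
  rewrite mod1Dz (@mod1_unique _ _ n) //; move: hA => /andP[h1 h2].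
  by apply/andP; split; lra.
(* Shifts are bounded by the number of edits, so they perturb [u] by at most [e], and the perturbed
   value stays in [[7 e, 1 - 7 e]]. *)
have small i : (i < B)%N -> `|(k i)%:~R * t| <= e.
  move=> iB; apply: le_trans Ee; rewrite normrM tE ler_wpM2r //.
  rewrite -intr_norm -[E%:R]/(E%:~R) ler_int; apply: kE; exact: ltnW.
have phase' i : q%:R * (y + (i * q)%:R * a + (k i)%:~R * a - (x + (i * q)%:R * a))
    = u + (k i)%:~R * t + (N0 + k i * p)%:~R.
  rewrite intrD intrM [RHS](_ : _ = u + N0%:~R + (k i)%:~R * (t + p%:~R)); last by ring.
  by rewrite -phase tE; ring.
have := small b bB; have := small b' bB'; rewrite !ler_norml.
move=> /andP[s1 s2] /andP[s3 s4].
have [n1 f1] := hb1 b hb; have [n2 f2] := hb2 b' hb'.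
have {}f1 : 2 * e <= mod1 (q%:R * (x + (b * q)%:R * a)) <= 2 * e + 2 * e.
  by apply: phaseE f1; lra.
have {}f2 : 1 - 4 * e <= mod1 (q%:R * (x + (b' * q)%:R * a)) <= 1 - 4 * e + 2 * e.
  by apply: phaseE f2; lra.
move: f1 f2 => /andP[f11 f12] /andP[f21 f22].
have ha1 : rho < 1 by lra.
have [||||lo _] := @same_block_cases _ a beta rho q p _ _ _ _ _ rhoE ha1 q_gt0 cpq qb qb'
  erefl _ _ _ _ (phase' b) (hs b bB cb); [lra..|].
have [||||_ hi] := @same_block_cases _ a beta rho q p _ _ _ _ _ rhoE ha1 q_gt0 cpq qb qb'
  erefl _ _ _ _ (phase' b') (hs b' bB' cb'); [lra..|].
have [|m1 hm1] := lo; first by lra.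
have [|m2 hm2] := hi; first by lra.
(* Subtracting the two shift equations cancels [u]: a change of type is a rotation by about
   [1 / q]. *)
have key : (k b - k b')%:~R * a - (m1 - m2)%:~R =
    ((k b)%:~R * t - (k b')%:~R * t + 1) / q%:R.
  have E1 : (k b)%:~R * a = (u + (k b)%:~R * t) / q%:R + m1%:~R - (y - x).
    by rewrite -hm1; ring.
  have E2 : (k b')%:~R * a = (u + (k b')%:~R * t - 1) / q%:R + m2%:~R - (y - x).
    by rewrite -hm2; ring.
  by rewrite !intrB mulrBl E1 E2; field; rewrite gt_eqF.
apply: (hK _ (m1 - m2)).
  (* Equal shifts would make [1 / q] an integer. *)
  apply/eqP => k0; move: key.
  have -> : (k b)%:~R * t = (k b')%:~R * t.
    by congr (_%:~R * _); apply/eqP; rewrite -subr_eq0 k0.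
  rewrite k0 subrr add0r mul0r sub0r -intrN => key.
  have i0 : 0 < 1 / q%:R :> R by rewrite divr_gt0.
  move: i0 q3; rewrite -key -[1]/(1%:~R) !ltr_int ltr0z; clear; lia.
rewrite key normrM [`|q%:R^-1|]gtr0_norm ?invr_gt0 // ler_pM2r ?invr_gt0 //.
by rewrite ler_norml; apply/andP; split; lra.
Qed.

(** With fewer edits than blocks some block is copied, and its shift is bounded by the number of
    edits. *)
Lemma edits_near a beta q p x y N B :
  let E := min_edits (xi_word a beta N x) (xi_word a beta N y) in
  (0 < q)%N -> coprime `|p| q ->
  q%:R * `|q%:R * a - p%:~R| < 1 ->
  3 / q%:R <= beta -> 3 / q%:R <= 1 - beta ->
  (B * q <= N)%N -> (E < B)%N ->
  exists k n : int, `|k| <= E%:Z /\ `|y - x + k%:~R * a - n%:~R| < 3 / q%:R.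
Proof.
move=> E q_gt0 cpq rho1 qb qb' hB EB.
have [c [k [hc hk kE hs]]] := @edits_blocks a beta q N B x y hB.
have [[b hb cb]|] := zero_or_sum_ge c 0 B; last first.
  by rewrite add0n => /leq_trans/(_ hc); rewrite leqNgt EB.
have bB : (b < B)%N by move: hb; clear; lia.
have [m mE] := mod1_split (y - x + (k b)%:~R * a).
have sh : y + (b * q)%:R * a + (k b)%:~R * a - (x + (b * q)%:R * a)
    = mod1 (y - x + (k b)%:~R * a) + m%:~R.
  by rewrite -mE; ring.
have := same_block_near q_gt0 cpq rho1 qb qb' sh (hs b bB cb).
move: mE (mod1_ge0 (y - x + (k b)%:~R * a)) (mod1_lt1 (y - x + (k b)%:~R * a)).
move: (mod1 _) => d mE d0 d1.
case=> d3; exists (k b).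
  exists m; split; first by apply: kE; exact: ltnW.
  by rewrite mE addrK ger0_norm.
exists (m + 1); split; first by apply: kE; exact: ltnW.
rewrite mE intrD.
have -> : d + m%:~R - (m%:~R + 1%:~R) = - (1 - d) by ring.
by rewrite normrN ger0_norm //; lra.
Qed.

End Lower.

(** * Upper bound for the number of edits *)

Section Upper.
Context {R : realType}.
Implicit Types (a beta x y X A d : R) (q N M : nat) (p n : int).

(* The orbit points in the interval have distinct numerators modulo [q] after
   rounding to the rational rotation, and these lie in a range of length 5. *)
Lemma hits_block a q p X A : (0 < q)%N -> coprime `|p| q ->
  q%:R * `|q%:R * a - p%:~R| < 1 ->
  (\sum_(0 <= j < q) (A <= mod1 (X + j%:R * a) < A + 3 / q%:R)%R <= 6)%N.
Proof.
move=> q_gt0 cpq rho1; have q0 : 0 < q%:R :> R by rewrite ltr0n.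
have [g gE] := mod1_split (q%:R * X).
have [t tE] : exists t, t = q%:R * a - p%:~R by eexists.
rewrite -tE in rho1.
pose nn (j : 'I_q) := Num.floor (X + j%:R * a).
pose r (j : 'I_q) : int := g + (j : nat)%:Z * p - q%:Z * nn j.
have [f fE] : exists f, f = mod1 (q%:R * X) by eexists.
rewrite -fE in gE.
pose L := Num.floor (q%:R * A - f - 1).
pose S := [set j : 'I_q | A <= mod1 (X + j%:R * a) < A + 3 / q%:R].
have rP j : j \in S -> 0 <= r j - L < 6.
  rewrite inE => /andP[h1 h2].
  have vE : q%:R * mod1 (X + j%:R * a) = f + (r j)%:~R + j%:R * t.
    rewrite /mod1 -/(nn j) mulrBr mulrDr gE /r intrB intrD !intrM tE.
    by rewrite -[(j : nat)%:~R]/(j%:R) -[q%:~R]/(q%:R); ring.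
  have jt : `|j%:R * t| < 1.
    apply: le_lt_trans rho1; rewrite normrM ger0_norm ?ler0n // ler_wpM2r //.
    by rewrite ler_nat ltnW.
  have h1' : q%:R * A <= f + (r j)%:~R + j%:R * t by rewrite -vE ler_pM2l.
  have h2' : f + (r j)%:~R + j%:R * t < q%:R * A + 3.
    have := h2; rewrite -(ltr_pM2l q0) vE mulrDr [q%:R * (3 / _)]mulrC.
    by rewrite divfK ?gt_eqF.
  have /andP[L1 L2] := floor_itv (q%:R * A - f - 1).
  rewrite -/L in L1 L2; rewrite intrD in L2.
  move: jt; rewrite ltr_norml => /andP[j1 j2].
  rewrite -(ler_int R) -(ltr_int R) intrB; clear -L1 L2 j1 j2 h1' h2'.
  by apply/andP; split; lra.
pose F (j : 'I_q) : 'I_6 := inord `|r j - L|%N.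
have Finj : {in S &, injective F}.
  move=> i j iS jS /(congr1 val); have := rP i iS; have := rP j jS => hj hi.
  rewrite /F /= !inordK; [|move: hi hj; clear; lia..].
  move=> E; have {E} : r i = r j by move: E hi hj; clear; lia.
  rewrite /r => E; apply: val_inj => /=.
  have /(congr1 absz) {E} : ((i : nat)%:Z - (j : nat)%:Z) * p = q%:Z * (nn i - nn j).
    move: E; clear; move: (nn i) (nn j) => b c E; rewrite !mulrBr !mulrBl; lia.
  rewrite !abszM absz_nat => E.
  have : (q %| `|(i : nat)%:Z - (j : nat)%:Z|)%N.
    have := dvdn_mulr `|nn i - nn j| (dvdnn q); rewrite -E Gauss_dvdl //.
    by rewrite coprime_sym.
  have := ltn_ord i; have := ltn_ord j; case: (posnP `|(i : nat)%:Z - (j : nat)%:Z|).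
    by clear; lia.
  by move=> h1 h2 h3 /(dvdn_leq h1); move: h1 h2 h3; clear; lia.
have -> : (\sum_(0 <= j < q) (A <= mod1 (X + j%:R * a) < A + 3 / q%:R)%R)%N = #|S|.
  rewrite big_mkord -sum1_card big_mkcond [RHS]big_mkcond /=.
  by apply: eq_bigr => j _; rewrite inE; case: (_ <= _ < _).
rewrite -(card_in_imset Finj); apply: leq_trans (max_card _) _.
by rewrite card_ord.
Qed.

Lemma hits_le a q p X A N : (0 < q)%N -> coprime `|p| q ->
  q%:R * `|q%:R * a - p%:~R| < 1 ->
  (\sum_(0 <= j < N) (A <= mod1 (X + j%:R * a) < A + 3 / q%:R)%R
     <= 6 * (N %/ q).+1)%N.
Proof.
move=> q_gt0 cpq rho1.
have H M : (\sum_(0 <= j < M * q) (A <= mod1 (X + j%:R * a) < A + 3 / q%:R)%R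
    <= 6 * M)%N.
  elim: M => [|M IH]; first by rewrite big_geq.
  rewrite (@big_cat_nat _ _ _ (M * q)) //=; last by rewrite leq_mul2r leqnSn orbT.
  rewrite mulnS addnC leq_add // -{1}[(M * q)%N]add0n big_addn mulSn addnK.
  apply: leq_trans (hits_block (X + (M * q)%:R * a) A q_gt0 cpq rho1).
  apply: leq_sum => j _; rewrite natrD mulrDl addrA.
  by rewrite addrAC.
apply: leq_trans (H _); apply: (@sum_nat_mono _ 0 N 0) => //.
by rewrite ltnW // ltn_ceil.
Qed.

(** Dropping [k < q] letters moves [x] to a point less than [3 / q] to the right of [y]. Letters
    then differ only when the orbit of [y] is within [3 / q] to the left of [beta] or of 1, and
    [hits_le] counts both kinds of visits. *)
Lemma edits_upper a beta q p N x y : beta < 1 -> (3 <= q)%N -> coprime `|p| q ->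
  q%:R * `|q%:R * a - p%:~R| < 1 ->
  (min_edits (xi_word a beta N x) (xi_word a beta N y)
     <= 2 * q + 24 * (N %/ q).+1)%N.
Proof.
move=> beta1 q3 cpq rho1; have q_gt0 : (0 < q)%N by apply: leq_trans q3.
have q0 : 0 < q%:R :> R by rewrite ltr0n.
have [k [n [kq hk]]] := orbit_hit_itv x y q_gt0 cpq rho1.
have [d dE] : exists d, d = x + k%:R * a - n%:~R - y by eexists.
have d0 : 0 <= d by move: hk => /andP[h _]; rewrite dE subr_ge0.
have d3 : d < 3 / q%:R by move: hk => /andP[_ h]; rewrite dE ltrBlDl.
have d1 : d < 1.
  by apply: lt_le_trans d3 _; rewrite ler_pdivrMr // mul1r ler_nat.
apply: leq_trans (@min_edits_shift _ false _ _ k _) _; first by rewrite !size_mkseq.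
apply: leq_add; first by rewrite leq_mul2l ltnW.
have -> : (24 = 2 * 12)%N by []. rewrite -mulnA leq_mul2l /= size_mkseq.
have h1 := @hits_le a q p y (1 - 3 / q%:R) N q_gt0 cpq rho1.
have h2 := @hits_le a q p y (beta - 3 / q%:R) N q_gt0 cpq rho1.
have -> : (12 * (N %/ q).+1 = 6 * (N %/ q).+1 + 6 * (N %/ q).+1)%N.
  by rewrite -mulnDl.
apply: leq_trans (leq_add h1 h2); rewrite -big_split /=.
apply: leq_trans (@sum_nat_mono _ 0 (N - k) 0 N _ _) => //; last exact: leq_subr.
rewrite !big_nat; apply: leq_sum => i /andP[_ iN].
rewrite !nth_mkseq; [|by move: iN; clear; lia..].
rewrite !xi_mod1.
have -> : x + (k + i)%N%:~R * a = y + i%:R * a + d + n%:~R.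
  by rewrite dE -[(k + i)%N%:~R]/((k + i)%:R) natrD; ring.
rewrite mod1Dz -[i%:~R]/(i%:R).
have z0 := mod1_ge0 (y + i%:R * a); have z1 := mod1_lt1 (y + i%:R * a).
rewrite !subrK.
have [lt|ge] := ltP (mod1 (y + i%:R * a) + d) 1.
  rewrite mod1D_lt //; move: lt z0 z1; move: (mod1 _) => z lt z0 z1.
  have [zb|zb] := ltP z beta; last by rewrite [_ + d < beta]ltNge (le_trans zb) ?lerDl.
  have [//|zdb] := ltP (z + d) beta; rewrite addnC.
  by have -> : beta - 3 / q%:R <= z by move: d3 zdb; clear; lra.
move: ge z0 z1; move: (mod1 _) => z ge z0 z1.
rewrite z1; have -> : 1 - 3 / q%:R <= z by move: d3 ge; clear; lra.
by case: (_ != _).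
Qed.

End Upper.

(** * Typical pairs *)

Section Typical.
Local Open Scope classical_set_scope.
Local Open Scope ring_scope.
Context {R : realType}.
Implicit Types (q : nat) (t : R) (n : int).
Local Notation lambda := (@lebesgue_measure R).

(** Only the first coordinate is confined to the torus, so that the sections are full intervals and
    the measure is exact. *)
Definition strip q t n : set (R * R) :=
  [set xy | torus xy.1 /\ `|q%:R * (xy.2 - xy.1) - n%:~R| < t].

Lemma measurable_strip q t n : measurable (strip q t n).
Proof.
have mf : measurable_fun [set: R * R] (fun xy => q%:R * (xy.2 - xy.1) : R).
  apply: measurable_funM => //; apply: measurable_funB.
    exact: measurable_snd.
  exact: measurable_fst.
have -> : strip q t n = (torus `*` setT) `&`
    ([set: R * R] `&` (fun xy => q%:R * (xy.2 - xy.1) : R) @^-1`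
      `]n%:~R - t, n%:~R + t[).
  apply/seteqP; split => [[x y] /= [h1 h2]|[x y] /= [[h1 _] [_ h2]]].
    split=> //; split=> //; rewrite /= in_itv /=; move: h2.
    move: (q%:R * _) (n%:~R) => v w; rewrite ltr_norml => /andP[? ?].
    by apply/andP; split; lra.
  split=> //; move: h2; rewrite /= in_itv /=.
  move: (q%:R * _) (n%:~R) => v w /andP[? ?].
  by rewrite ltr_norml; apply/andP; split; lra.
apply: measurableI; first by apply: measurableX => //; exact: measurable_itv.
by apply: mf => //; exact: measurable_itv.
Qed.

Lemma measure_strip q t n : (0 < q)%N -> 0 <= t ->
  (lambda \x lambda)%E (strip q t n) = (2 * t / q%:R)%:E.
Proof.
move=> q_gt0 t0; have q0 : 0 < q%:R :> R by rewrite ltr0n.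
rewrite /= /product_measure1 /=.
transitivity (\int[lambda]_x ((\1_(@torus R) x)%:E * (2 * t / q%:R)%:E))%E.
  apply: eq_integral.
  move=> x _; rewrite indicE /=.
  have [xT|xT] := boolP (x \in (torus : set R)); last first.
    rewrite mul0e; have -> : xsection (strip q t n) x = set0; last exact: measure0.
    apply/seteqP; split => // y; rewrite /xsection /= inE => -[/= h _].
    by move: xT; rewrite notin_setE.
  rewrite mul1e.
  have -> : xsection (strip q t n) x =
      `]x + (n%:~R - t) / q%:R, x + (n%:~R + t) / q%:R[%classic.
    apply/seteqP; split => y; rewrite /xsection /= inE in_itv /=.
      move=> [/= _]; rewrite ltr_norml => /andP[h1 h2].
      rewrite -ltrBrDl -[y < _]ltrBlDl ltr_pdivrMr // ltr_pdivlMr // [_ * q%:R]mulrC.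
      by move: (q%:R * _) (n%:~R) h1 h2 => v w h1 h2; apply/andP; split; lra.
    rewrite -ltrBrDl -[y < _]ltrBlDl ltr_pdivrMr // ltr_pdivlMr //.
    rewrite [_ * q%:R]mulrC => /andP[h1 h2].
    split=> /=; first by move: xT; rewrite inE.
    rewrite ltr_norml; move: (q%:R * _) (n%:~R) h1 h2 => v w h1 h2.
    by apply/andP; split; lra.
  rewrite lebesgue_measure_itv /= lte_fin.
  have E : x + (n%:~R + t) / q%:R - (x + (n%:~R - t) / q%:R) = 2 * t / q%:R.
    by field; rewrite gt_eqF.
  case: ltP => h; first by rewrite -EFinB E.
  have : 0 <= 2 * t / q%:R by rewrite divr_ge0 ?mulr_ge0 // ltW.
  by move=> h'; congr (_%:E); lra.
rewrite ge0_integralZr //=.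
- rewrite integral_indic //= ?setIT; last exact: measurable_itv.
  by rewrite /torus lebesgue_measure_itv /= lte_fin ltr01 oppr0 adde0 mul1e.
- by apply/measurable_EFinP; apply: measurable_indic; exact: measurable_itv.
- by rewrite lee_fin divr_ge0 ?mulr_ge0 // ltW.
Qed.

(** On the torus [q (y - x)] lies between [- q] and [q], so for [t <= 1] only the integers from
    [- q] to [q] matter. *)
Definition near_lattice q t : set (R * R) :=
  \big[setU/set0]_(i < (2 * q)%N.+1) strip q t (i%:Z - q%:Z).

Lemma near_latticeP q t xy n : 0 <= t -> t <= 1 -> (torus `*` torus) xy ->
  `|q%:R * (xy.2 - xy.1) - n%:~R| < t -> near_lattice q t xy.
Proof.
move=> t0 t1 [/= h1 h2] hn.
have [n1 n2] : n <= q%:Z /\ - q%:Z <= n.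
  move: h1 h2; rewrite /torus /= !in_itv /= => /andP[x0 x1] /andP[y0 y1].
  have q0 : 0 <= q%:R :> R by [].
  have b1 : q%:R * (xy.2 - xy.1) <= q%:R by rewrite ler_piMr //; lra.
  have b2 : - q%:R <= q%:R * (xy.2 - xy.1).
    by rewrite -mulrN1 ler_wpM2l //; lra.
  move: hn; rewrite ltr_norml => /andP[c1 c2].
  split; rewrite -ltzD1 -(ltr_int R) ?intrD ?intrN; [lra|].
  rewrite -[q%:~R]/(q%:R); lra.
rewrite /near_lattice.
have := @bigsetU_sup _ `|(n + q%:Z)%R|%N (2 * q)%N.+1 (fun i => strip q t (i%:Z - q%:Z)).
apply; first by move: n1 n2; clear; lia.
split=> //; suff -> : `|(n + q%:Z)%R|%N%:Z - q%:Z = n by [].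
by move: n1 n2; clear; lia.
Qed.

Lemma measurable_near_lattice q t : measurable (near_lattice q t).
Proof. by apply: bigsetU_measurable => i _; exact: measurable_strip. Qed.

(** There are [2 q + 1] strips of measure [2 t / q]; the bound does not depend on [q]. *)
Lemma measure_near_lattice q t : (0 < q)%N -> 0 <= t ->
  ((lambda \x lambda) (near_lattice q t) <= (6 * t)%:E)%E.
Proof.
move=> q_gt0 t0; have q0 : 0 < q%:R :> R by rewrite ltr0n.
apply: (@le_trans _ _ (\sum_(i < (2 * q)%N.+1) (2 * t / q%:R)%:E)%E).
  apply: le_trans (@Boole_inequality _ _ _ (lambda \x lambda)%E
    (fun i => strip q t (i%:Z - q%:Z)) _ _) _.
    by move=> i _; exact: measurable_strip.
  apply: lee_sum => i _; rewrite le_eqVlt; apply/orP; left; apply/eqP.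
  exact: measure_strip.
rewrite sumEFin lee_fin sumr_const card_ord.
have -> : (2 * t / q%:R) *+ (2 * q)%N.+1 = 4 * t + 2 * t / q%:R :> R.
  rewrite -[LHS]mulr_natr -[(2 * q)%N.+1%:R]natr1 [(2 * q)%N%:R]natrM.
  by field; rewrite gt_eqF.
have : t / q%:R <= t by rewrite ler_pdivrMr // ler_peMr // ler1n.
by move=> h; rewrite -mulrA; lra.
Qed.

(** First Borel-Cantelli lemma: the measures have bounded partial sums, so the limit superior of the
    exceptional sets is null. *)
Lemma ae_far_from_lattice (q : nat -> nat) (t : nat -> R) (C : R) :
  (forall i, (0 < q i)%N) -> (forall i, 0 <= t i) -> (forall i, t i <= 1) ->
  (forall k : nat, \sum_(0 <= i < k) t i <= C) ->
  {ae (lambda \x lambda)%E, forall xy, (torus `*` torus) xy ->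
    exists M, forall m, (M <= m)%N -> forall n : int,
      t m <= `|(q m)%:R * (xy.2 - xy.1) - n%:~R|}.
Proof.
move=> q0 t0 t1 tC.
pose F i := near_lattice (q i) (t i).
have mF i : measurable (F i) by exact: measurable_near_lattice.
exists (lim_sup_set F); split.
- apply: bigcap_measurable => // k _.
  by apply: bigcup_measurable => j /= _; exact: mF.
- apply: lim_sup_set_cvg0 => //.
  apply: (@le_lt_trans _ _ (6 * C)%:E); last exact: ltry.
  apply: lime_le; first by apply: is_cvg_nneseries => n _ _; exact: measure_ge0.
  apply: nearW => n.
  apply: (@le_trans _ _ (\sum_(0 <= i < n) (6 * t i)%:E)%E).
    by apply: lee_sum => i _; exact: measure_near_lattice.
  by rewrite sumEFin lee_fin -mulr_sumr ler_pM2l.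
- move=> xy /= /not_implyP[Txy /forallNP H] m _.
  have /existsNP[k /not_implyP[mk /existsNP[n /negP]]] := H m.
  rewrite -ltNge => hn; exists k => //.
  exact: (near_latticeP (t0 k) (t1 k) Txy hn).
Qed.

End Typical.

(** * Typical pairs have large edit distance *)

Section PowR.
Context {R : realType}.
Implicit Types x y r s : R.

Lemma powR_le_base r x y : 0 <= r -> 0 <= x -> x <= y -> x `^ r <= y `^ r.
Proof.
by move=> r0 x0 xy; apply: ge0_ler_powR => //; rewrite nnegrE // (le_trans x0).
Qed.

Lemma powRD_gt0 x r s : 0 < x -> x `^ (r + s) = x `^ r * x `^ s.
Proof. by move=> x0; rewrite powRD // (gt_eqF x0) implybT. Qed.

End PowR.

(** * The lower bound at one scale, in two regimes of [q |q a - p|] *)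

Section Core.
Context {R : realType}.
Implicit Types (a beta x y c eta s : R) (q m l N h : nat) (p n : int).

(** Here [q] is almost [2^m]. Few edits would put [y - x + k a] within [3 / q] of an integer for a
    small [k]. Multiplying by [q'] puts [q' (y - x)] within [4 / 2^l] of an integer, against
    typicality; the coarser scale serves to make [3 q' / q] small. *)
Lemma core_near a beta x y q q' p p' m l N :
  let E := min_edits (xi_word a beta N x) (xi_word a beta N y) in
  least_denom a m q p -> least_denom a (m - 4 * l) q' p' -> (4 * l <= m)%N ->
  3 / q%:R <= beta -> 3 / q%:R <= 1 - beta ->
  2^-1 ^+ l < q%:R * `|q%:R * a - p%:~R| ->
  (forall n : int, 8 * 2^-1 ^+ l <= `|q'%:R * (y - x) - n%:~R|) ->
  (2 ^ m * q <= N)%N -> (2 ^ m <= E * 2 ^ (6 * l))%N.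
Proof.
move=> E ld ld' lm qb qb' hrho typ hN.
rewrite leqNgt; apply/negP => hE.
have [q_gt0 hq _] := ld; have [q'_gt0 hq' _] := ld'.
have EB : (E < 2 ^ m)%N.
  by apply: leq_ltn_trans hE; rewrite leq_pmulr // expn_gt0.
have [k [n [kE kn]]] := edits_near q_gt0 (least_denom_coprime ld)
  (least_denom_rho ld) qb qb' hN EB.
have q0 : 0 < q%:R :> R by rewrite ltr0n.
have [z zE] : exists z : R, z = 2 ^+ l by eexists.
have [X' X'E] : exists X' : R, X' = 2 ^+ (m - 4 * l) by eexists.
have z1 : 1 <= z by rewrite zE exprn_ege1 // ler1n.
have X'0 : 0 < X' by rewrite X'E exprn_gt0.
have XE : 2 ^+ m = X' * z ^+ 4 :> R.
  by rewrite X'E zE -exprM -exprD; congr (_ ^+ _); move: lm; clear; lia.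
have hE' : E%:R * z ^+ 6 < X' * z ^+ 4.
  rewrite -XE zE -exprM -!natrX -natrM ltr_nat.
  by rewrite [(l * 6)%N]mulnC.
rewrite exprVn -zE in hrho typ; rewrite exprVn XE in hq.
rewrite exprVn -X'E in hq'.
have z0 : 0 < z by apply: lt_le_trans z1.
have qbig : X' * z ^+ 3 < q%:R.
  have h : z^-1 < q%:R * (X' * z ^+ 4)^-1.
    by apply: lt_trans hrho _; rewrite ltr_pM2l.
  move: h; rewrite ltr_pdivlMr; last by rewrite mulr_gt0 ?exprn_gt0.
  by rewrite exprS mulrCA mulKf ?gt_eqF.
have q'le : q'%:R <= X'.
  by rewrite X'E -natrX ler_nat; exact: least_denom_le ld'.
have h8 := typ (q'%:Z * n - k * p').
have : `|q'%:R * (y - x) - (q'%:Z * n - k * p')%:~R| <=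
    q'%:R * `|y - x + k%:~R * a - n%:~R| + `|k%:~R| * `|q'%:R * a - p'%:~R|.
  rewrite -[q'%:R in X in _ <= X + _]ger0_norm // -!normrM.
  have -> : q'%:R * (y - x) - (q'%:Z * n - k * p')%:~R =
     q'%:R * (y - x + k%:~R * a - n%:~R) - k%:~R * (q'%:R * a - p'%:~R).
    by rewrite intrB !intrM -[q'%:~R]/(q'%:R); ring.
  exact: ler_normB.
move=> /(le_trans h8); apply/negP; rewrite -ltNge.
have b1 : q'%:R * `|y - x + k%:~R * a - n%:~R| <= 3 * z^-1.
  apply: (@le_trans _ _ (X' * (3 / q%:R))).
    by apply: ler_pM => //; exact: ltW.
  rewrite mulrCA ler_pM2l // ler_pdivrMr // mulrC ler_pdivlMr //.
  apply: le_trans (ltW qbig); rewrite ler_pM2l //.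
  by rewrite ler_eXnr.
have b2 : `|k%:~R| * `|q'%:R * a - p'%:~R| <= z^-1.
  apply: (@le_trans _ _ (E%:R * X'^-1)).
    apply: ler_pM => //; last exact: ltW.
    by rewrite -intr_norm -[E%:R]/(E%:~R) ler_int.
  rewrite ler_pdivrMr // mulrC ler_pdivlMr //.
  have : E%:R * z ^+ 6 < X' * z ^+ 4 := hE'.
  have -> : E%:R * z ^+ 6 = (E%:R * z * z) * z ^+ 4 by ring.
  rewrite ltr_pM2r ?exprn_gt0 // => /ltW; apply: le_trans.
  by rewrite ler_peMr // mulr_ge0 // ltW.
have zi0 : 0 < z^-1 by rewrite invr_gt0.
by move: b1 b2 zi0; clear; lra.
Qed.


(* [eta - 1 - 1 / eta <= s] with small [s] is the golden ratio condition: it makes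
   the cost of a change of shift comparable to that of the edits it avoids. *)
Lemma core_far a beta x y q p m l N c eta s :
  let E := min_edits (xi_word a beta N x) (xi_word a beta N y) in
  0 < c -> 1 <= eta -> eta <= 7 / 4 -> 0 <= s -> eta - 1 - eta^-1 <= s ->
  (forall k n, (0 < k)%N -> c * k%:R `^ (- eta) <= `|k%:R * a - n%:~R|) ->
  least_denom a m q p -> (0 < l)%N -> s * m%:R <= l.+1%:R ->
  beta < 1 -> 3 / q%:R <= beta -> 3 / q%:R <= 1 - beta ->
  q%:R * `|q%:R * a - p%:~R| <= 2^-1 ^+ l ->
  (forall n : int, 8 * 2^-1 ^+ l <= `|q%:R * (y - x) - n%:~R|) ->
  2 <= c * q%:R -> 3 / c <= (2 ^+ m) `^ 4^-1 ->
  24 < c * (c / 2) `^ eta^-1 * 2 ^+ (5 * l) ->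
  (2 ^ m * q <= N)%N -> (2 ^ m <= E * 2 ^ (6 * l))%N.
Proof.
move=> E c0 eta1 eta74 s0 etas liou ld l0 sm beta1 qb qb' hrho typ cq c3 C24 hN.
rewrite leqNgt; apply/negP => hE.
have [q_gt0 hq _] := ld.
have q0 : 0 < q%:R :> R by rewrite ltr0n.
have q1 : 1 <= q%:R :> R by rewrite ler1n.
have eta0 : 0 < eta by apply: lt_le_trans eta1.
have [z zE] : exists z : R, z = 2 ^+ l by eexists.
have [X XE] : exists X : R, X = 2 ^+ m by eexists.
have z2 : 2 <= z by rewrite zE ler_eXnr // ler1n.
have z0 : 0 < z by apply: lt_le_trans z2.
have X0 : 0 < X by rewrite XE exprn_gt0.
have qX : q%:R <= X by rewrite XE -natrX ler_nat; exact: least_denom_le ld.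
rewrite -XE in c3; rewrite exprVn -zE in hrho typ; rewrite exprVn -XE in hq.
rewrite [(5 * l)%N]mulnC exprM -zE in C24.
have hE' : E%:R * z ^+ 6 < X.
  by rewrite XE zE -exprM -!natrX -natrM ltr_nat [(l * 6)%N]mulnC.
have [rho rhoE] : exists rho, rho = q%:R * `|q%:R * a - p%:~R| by eexists.
rewrite -rhoE in hrho.
have rho_ge : c * q%:R `^ (1 - eta) <= rho.
  rewrite rhoE powRD_gt0 // powRr1 // mulrCA ler_pM2l //; exact: liou.
have rho0 : 0 < rho by apply: lt_le_trans rho_ge; rewrite mulr_gt0 // powR_gt0.
have rho1 : rho < 1 by rewrite rhoE; exact: least_denom_rho ld.
have [e eE] : exists e, e = z^-1 by eexists.
rewrite -eE in hrho typ.
have e0 : 0 < e by rewrite eE invr_gt0.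
(* [G] blocks move the phase by at most [e], [W] blocks make at least two turns, and [K] bounds from
   below the changes of shift that rotate by at most [2 / q]. *)
have G0 : 0 <= e / rho by rewrite divr_ge0 // ltW.
have /andP[G1 G2] := truncn_itv G0; set G := Num.truncn _ in G1 G2.
have W0 : 0 <= 2 / rho by rewrite divr_ge0 // ltW.
have /andP[W1 W2] := truncn_itv W0; set W := (Num.truncn _).+1 in W2.
have WE : W%:R = (Num.truncn (2 / rho))%:R + 1 :> R by rewrite natr1.
have K0 : 0 <= (c * q%:R / 2) `^ eta^-1 by exact: powR_ge0.
have /andP[K1 K2] := truncn_itv K0; set K := Num.truncn _ in K1 K2.
pose V := (2 ^ m %/ W)%N.
have hK (j n : int) : j != 0 -> `|j%:~R * a - n%:~R| <= 2 / q%:R -> K%:Z <= `|j|.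
  move=> j0 hj; have k0 : (0 < `|j|)%N by rewrite absz_gt0.
  have k0' : 0 < `|j|%N%:R :> R by rewrite ltr0n.
  have {}hj : c * `|j|%N%:R `^ (- eta) <= 2 / q%:R.
    apply: le_trans hj.
    have [jp|jn] := leP 0 j.
      apply: le_trans (liou `|j|%N n k0) _; rewrite le_eqVlt; apply/orP; left.
      by rewrite -[`|j|%N%:R]/((`|j|%N)%:Z%:~R) gez0_abs.
    apply: le_trans (liou `|j|%N (- n) k0) _; rewrite le_eqVlt; apply/orP; left.
    rewrite -[`|j|%N%:R]/((`|j|%N)%:Z%:~R) ltz0_abs // !intrN -normrN.
    by apply/eqP; congr (`|_|); ring.
  have cqk : c * q%:R / 2 <= `|j|%N%:R `^ eta.
    move: hj; rewrite powRN ler_pdivrMr ?powR_gt0 // mulrAC ler_pdivlMr //.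
    by move=> h; rewrite ler_pdivrMr // [_ * 2]mulrC.
  have : K%:R <= `|j|%N%:R :> R.
    apply: le_trans K1 _.
    have -> : `|j|%N%:R = (`|j|%N%:R `^ eta) `^ eta^-1 :> R.
      by rewrite -powRrM mulfV ?gt_eqF // powRr1 // ltW.
    apply: powR_le_base => //; first by rewrite invr_ge0 ltW.
    by rewrite !mulr_ge0 // ltW.
  by rewrite ler_nat; clear; lia.
have [N0 N0E] := mod1_split (q%:R * (y - x)).
have u8 : 8 * e <= mod1 (q%:R * (y - x)).
  have := typ N0; rewrite {1}N0E addrK ger0_norm //; exact: mod1_ge0.
have u8' : mod1 (q%:R * (y - x)) <= 1 - 8 * e.
  have := typ (N0 + 1); rewrite {1}N0E intrD.
  move: (mod1 _) (mod1_lt1 (q%:R * (y - x))) => u u1.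
  have -> : u + N0%:~R - (N0%:~R + 1%:~R) = - (1 - u) by ring.
  by rewrite normrN ger0_norm; move: u1; clear; lra.
have VW : (V * W <= 2 ^ m)%N by exact: leq_trunc_div.
have Ge : G%:R * rho <= e by rewrite -ler_pdivlMr.
have We : 2 <= W%:R * rho by rewrite -ler_pdivrMr // ltW.
have Ee : E%:R * `|q%:R * a - p%:~R| <= e.
  apply: (@le_trans _ _ (E%:R * X^-1)); first by rewrite ler_wpM2l // ltW.
  rewrite ler_pdivrMr // mulrC eE ler_pdivlMr //; apply: le_trans (ltW hE').
  by rewrite ler_wpM2l // ler_eXnr //; move: z2; clear; lra.
have low := edits_lower beta1 q_gt0 (least_denom_coprime ld) qb qb' rhoE rho0
  hrho N0E u8 u8' Ee Ge We hK hN VW.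
have W3 : W%:R <= 3 / rho.
  have h1 : 1 <= 1 / rho by rewrite ler_pdivlMr // mul1r ltW.
  have -> : 3 / rho = 2 / rho + 1 / rho by field; rewrite gt_eqF.
  by rewrite WE; apply: lerD.
(* This gives [V >= 1], so that rounding in [V] loses only a factor 2. It holds because [rho] is at
   least [c X^(-3/4)], by [eta <= 7 / 4]. *)
have WX : W%:R <= X.
  apply: le_trans W3 _; rewrite ler_pdivrMr //.
  have h1 : 3 <= c * X `^ 4^-1 by rewrite mulrC -ler_pdivrMr.
  apply: le_trans h1 _; rewrite mulrC.
  have XX : X = X `^ 4^-1 * X `^ (3 / 4).
    by rewrite -powRD_gt0 // -[LHS]powRr1 ?(ltW X0) //; congr (_ `^ _); field.
  rewrite [in leRHS]XX -mulrA ler_wpM2l ?powR_ge0 //.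
  apply: (@le_trans _ _ (X `^ (3 / 4) * (c * q%:R `^ (1 - eta)))); last first.
    by rewrite ler_wpM2l ?powR_ge0.
  rewrite mulrCA -[leLHS]mulr1 ler_pM2l //.
  have -> : 1 - eta = - (eta - 1) by ring.
  rewrite powRN ler_pdivlMr ?powR_gt0 // mul1r.
  apply: (@le_trans _ _ (X `^ (eta - 1))).
    by apply: powR_le_base => //; lra.
  apply: ler_powR; first exact: le_trans qX.
  by lra.
have V6 : X * rho / 6 <= V%:R.
  have W00 : (0 < W)%N by [].
  have V1 : (0 < V)%N by rewrite divn_gt0 // -(ler_nat R) natrX -XE.
  have hV : X <= V%:R * 2 * W%:R.
    rewrite XE -natrX -!natrM ler_nat; apply: ltnW.
    apply: leq_trans (ltn_ceil (2 ^ m) W00) _; rewrite leq_mul2r.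
    by apply/orP; right; rewrite -/V; move: V1; clear; lia.
  have := le_trans hV (ler_wpM2l (_ : 0 <= V%:R * 2) W3).
  rewrite mulrA ler_pdivlMr // => /(_ _) h.
  rewrite ler_pdivrMr //.
  have -> : V%:R * 6 = V%:R * 2 * 3 :> R by ring.
  by apply: h; rewrite mulr_ge0.
have final : V%:R * (minn G K)%:R * z ^+ 6 < X.
  apply: le_lt_trans hE'; rewrite ler_pM2r ?exprn_gt0 //.
  by rewrite -natrM ler_nat.
(* If the minimum is [G], then [rho] cancels in [V G], which is at least [X e / 12], and [z^5 >= 32]
   beats the constant. *)
have [GK|KG] := leqP G K.
  move: final; rewrite (minn_idPl GK); apply/negP; rewrite -leNgt.
  have erho : 1 <= e / rho by rewrite ler_pdivlMr // mul1r.
  have G2' : e / rho / 2 <= G%:R.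
    rewrite -natr1 in G2.
    have : (1 <= G)%N by rewrite -(ltr_nat R) in G2 *; move: G2 erho; clear; lra.
    by rewrite -(ler_nat R); move: G2; clear; lra.
  apply: (@le_trans _ _ (X * rho / 6 * (e / rho / 2) * z ^+ 6)).
    have -> : X * rho / 6 * (e / rho / 2) * z ^+ 6 = X * (z ^+ 5 / 12).
      by rewrite eE; field; rewrite !gt_eqF.
    rewrite -[leLHS]mulr1 ler_pM2l // ler_pdivlMr // mul1r.
    apply: (@le_trans _ _ (2 ^+ 5)); first by rewrite -natrX ler_nat.
    by rewrite lerXn2r // nnegrE // ltW.
  rewrite ler_pM2r ?exprn_gt0 //; apply: ler_pM => //.
    by rewrite divr_ge0 // mulr_ge0 // ltW.
  by rewrite divr_ge0.
move: final; rewrite (minn_idPr (ltnW KG)); apply/negP; rewrite -leNgt.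
have cq1 : 1 <= (c * q%:R / 2) `^ eta^-1.
  apply: (@le_trans _ _ (1 `^ eta^-1)); first by rewrite powR1.
  apply: powR_le_base; rewrite ?invr_ge0 ?(ltW eta0) //.
  by rewrite ler_pdivlMr // mul1r.
have K2' : (c * q%:R / 2) `^ eta^-1 / 2 <= K%:R.
  rewrite -natr1 in K2.
  have : (1 <= K)%N by rewrite -(ltr_nat R) in K2 *; move: K2 cq1; clear; lra.
  by rewrite -(ler_nat R); move: K2; clear; lra.
(* The golden ratio condition enters here: the loss [q^(1 - eta)] in [rho] is made up by the gain
   [q^(1 / eta)] in [K], up to [q^s <= 2 z]. *)
have qs : (2 * z)^-1 <= q%:R `^ (1 - eta) * q%:R `^ eta^-1.
  rewrite -powRD_gt0 //.
  apply: (@le_trans _ _ (q%:R `^ (- s))); last by apply: ler_powR => //; lra.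
  rewrite powRN lef_pV2 ?posrE ?powR_gt0 ?mulr_gt0 //.
  apply: (@le_trans _ _ (X `^ s)); first by apply: powR_le_base => //; exact: ltW.
  rewrite XE zE -exprS -!powR_mulrn // -powRrM; apply: ler_powR; first by rewrite ler1n.
  by rewrite mulrC.
apply: (@le_trans _ _ (X * rho / 6 * ((c * q%:R / 2) `^ eta^-1 / 2) * z ^+ 6)); last first.
  rewrite ler_pM2r ?exprn_gt0 //; apply: ler_pM => //.
    by rewrite divr_ge0 // mulr_ge0 // ltW.
  by rewrite divr_ge0.
apply: (@le_trans _ _ (X * (c * q%:R `^ (1 - eta)) / 6 *
    ((c * q%:R / 2) `^ eta^-1 / 2) * z ^+ 6)); last first.
  rewrite ler_pM2r ?exprn_gt0 // ler_wpM2r ?divr_ge0 // ler_pM2r //.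
  by rewrite ler_pM2l.
have -> : c * q%:R / 2 = c / 2 * q%:R by ring.
rewrite powRM ?divr_ge0 ?(ltW c0) //.
move: qs C24; move: (q%:R `^ (1 - eta)) (q%:R `^ eta^-1) ((c / 2) `^ _) => A B D qs C24.
have -> : X * (c * A) / 6 * (D * B / 2) * z ^+ 6 =
  X * ((c * D * z ^+ 5) * (A * B) * z / 12) by field.
rewrite -[leLHS]mulr1 ler_pM2l // ler_pdivlMr // mul1r.
apply: (@le_trans _ _ (24 * (2 * z)^-1 * z)).
  by have -> : 24 * (2 * z)^-1 * z = 12 by field; rewrite gt_eqF.
rewrite ler_pM2r //; apply: ler_pM => //.
  by rewrite invr_ge0 mulr_ge0 // ltW.
exact: ltW.
Qed.

End Core.

(** * The irrationality exponent *)

Section Exponent.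
Local Open Scope classical_set_scope.
Local Open Scope ring_scope.
Context {R : realType}.
Implicit Types (a m : R) (q k : nat) (p n : int).

Lemma finite_pos_lower_bound (T : choiceType) (S : set T) (g : T -> R) :
  finite_set S -> (forall s, S s -> 0 < g s) ->
  exists2 e, 0 < e & forall s, S s -> e <= g s.
Proof.
move=> /finite_seqP[r ->].
elim: r => [|x r IH] pos; first by exists 1.
have [|e e0 he] := IH; first by move=> s sr; apply: pos; rewrite /= inE sr orbT.
have gx : 0 < g x by apply: pos; rewrite /= inE eqxx.
exists (Num.min e (g x)); first by rewrite lt_min e0 gx.
move=> s; rewrite /= inE => /orP[/eqP ->|/he h]; first by rewrite ge_min lexx orbT.
by rewrite ge_min h.
Qed.

Lemma irrational_dist_gt0 a q p : irrational a -> (0 < q)%N ->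
  0 < `|q%:R * a - p%:~R|.
Proof.
move=> irr q_gt0; have q0 : 0 < q%:R :> R by rewrite ltr0n.
rewrite normr_gt0 subr_eq0; apply/eqP => E; apply: irr.
exists (p%:~R / q%:R) => //.
rewrite rmorph_div /= ?rmorph_nat ?ratr_int -?E; first by rewrite mulrC mulKf ?gt_eqF.
by rewrite unitfE pnatr_eq0 -lt0n.
Qed.

Definition approximations a m : set (int * nat) :=
  [set pq | (0 < pq.2)%N /\
    0 < `|a - pq.1%:~R / pq.2%:R| < pq.2%:R `^ (- m)].

Lemma approximationsE a m p q : irrational a -> (0 < q)%N ->
  approximations a m (p, q) <-> `|q%:R * a - p%:~R| < q%:R `^ (1 - m).
Proof.
move=> irr q_gt0; have q0 : 0 < q%:R :> R by rewrite ltr0n.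
have E : `|a - p%:~R / q%:R| = `|q%:R * a - p%:~R| / q%:R.
  have -> : a - p%:~R / q%:R = (q%:R * a - p%:~R) / q%:R by field; rewrite gt_eqF.
  by rewrite normrM normfV [`|q%:R|]gtr0_norm.
have pos : 0 < `|a - p%:~R / q%:R| by rewrite E divr_gt0 // irrational_dist_gt0.
have -> : (`|q%:R * a - p%:~R| < q%:R `^ (1 - m)) =
    (`|a - p%:~R / q%:R| < q%:R `^ (- m)).
  by rewrite E ltr_pdivrMr // powRD_gt0 // powRr1 ?ltW // [_ `^ _ * _]mulrC.
by rewrite /approximations /= pos /=; split => [[]|].
Qed.

(** If there were finitely many, their errors [|q a - p|] would exceed some [e > 0], and Dirichlet
    with [Q > 1 / e] would produce another one. *)
Lemma infinite_approximations2 a : irrational a -> infinite_set (approximations a 2).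
Proof.
move=> irr fin.
have [|e e0 he] := @finite_pos_lower_bound _ _
  (fun pq : int * nat => `|pq.2%:R * a - pq.1%:~R|) fin.
  by move=> [p q] [/= q0 _]; exact: irrational_dist_gt0.
have ei : 0 <= e^-1 by rewrite invr_ge0 ltW.
have /andP[_ Q1] := truncn_itv ei; set Q := (Num.truncn _).+1 in Q1.
have [//|q [p [q_gt0 qQ h]]] := @dirichlet R a Q.
have q0 : 0 < q%:R :> R by rewrite ltr0n.
have S : approximations a 2 (p, q).
  apply/approximationsE => //.
  have -> : 1 - 2 = -1 :> R by ring.
  rewrite powR_inv1 ?ltW //; apply: lt_le_trans h _.
  by rewrite lef_pV2 ?posrE ?ltr0n // ler_nat.
have := he _ S; apply/negP; rewrite -ltNge; apply: lt_trans h _.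
by rewrite -[ltRHS]invrK ltf_pV2 ?posrE ?invr_gt0 ?ltr0n.
Qed.

Lemma irr_exponent_ge2 a : irrational a -> (2%:E <= irr_exponent a)%E.
Proof.
move=> irr; apply: ereal_sup_ubound; exists 2 => //.
exact: infinite_approximations2.
Qed.

(** Only finitely many pairs violate the bound with constant 1; [c] is lowered to accommodate
    them. *)
Lemma liouville_bound a m : irrational a -> (irr_exponent a < m%:E)%E ->
  exists2 c, 0 < c & forall q p, (0 < q)%N ->
    c * q%:R `^ (1 - m) <= `|q%:R * a - p%:~R|.
Proof.
move=> irr mu.
have fin : finite_set (approximations a m).
  apply: contrapT => inf; move: mu; apply/negP; rewrite -leNgt.
  by apply: ereal_sup_ubound; exists m.
have [|e e0 he] := @finite_pos_lower_bound _ _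
  (fun pq : int * nat => `|pq.2%:R * a - pq.1%:~R| / pq.2%:R `^ (1 - m)) fin.
  move=> [p q] [/= q_gt0 _]; rewrite divr_gt0 ?irrational_dist_gt0 //.
  by apply: powR_gt0; rewrite ltr0n.
exists (Num.min 1 e); first by rewrite lt_min ltr01.
move=> q p q_gt0; have q0 : 0 < q%:R :> R by rewrite ltr0n.
have P0 : 0 < q%:R `^ (1 - m) by rewrite powR_gt0.
have [h|h] := ltP `|q%:R * a - p%:~R| (q%:R `^ (1 - m)).
  have := he (p, q) (iffRL (approximationsE m p irr q_gt0) h).
  rewrite /= ler_pdivlMr //; apply: le_trans.
  by rewrite ler_wpM2r ?ge_min ?lexx ?orbT // ltW.
by apply: le_trans h; rewrite ger_pMl // ge_min lexx.
Qed.

(** Infinitely many approximations with some larger exponent exist, and those with denominator at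
    most [k] have numerators in [[- B, B]], hence are finite in number. *)
Lemma good_approximations a m k : irrational a -> 0 <= m ->
  (m%:E < irr_exponent a)%E ->
  exists q p, (k < q)%N /\ `|q%:R * a - p%:~R| < q%:R `^ (1 - m).
Proof.
move=> irr m0 /ereal_sup_gt[_ [m' inf <-]]; rewrite lte_fin => mm'.
apply: contrapT => H; apply: inf.
have [B B1] : exists B : nat, k%:R * (`|a| + 1) <= B%:R :> R.
  exists (Num.truncn (k%:R * (`|a| + 1))).+1; apply: ltW.
  have B0 : 0 <= k%:R * (`|a| + 1) by rewrite mulr_ge0 ?addr_ge0.
  by have /andP[] := truncn_itv B0.
pose f (ij : nat * nat) := (ij.1%:Z - B%:Z, ij.2).
apply: (@sub_finite_set _ _ (f @` (`I_(2 * B).+1 `*` `I_k.+1))); last first.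
  by apply: finite_image; apply: finite_setX; exact: finite_II.
move=> [p q] hpq; have [/= q_gt0 /andP[_ hq]] := hpq.
have q0 : 0 < q%:R :> R by rewrite ltr0n.
have q1 : 1 <= q%:R :> R by rewrite ler1n.
have qk : (q <= k)%N.
  rewrite leqNgt; apply/negP => kq; apply: H; exists q, p; split => //.
  have /lt_le_trans := iffLR (approximationsE m' p irr q_gt0) hpq; apply.
  by apply: ler_powR => //; lra.
have : `|p%:~R| <= B%:R :> R.
  apply: le_trans B1; have h := iffLR (approximationsE m' p irr q_gt0) hpq.
  have h1 : q%:R `^ (1 - m') <= q%:R.
    by rewrite -[leRHS]powRr1 ?ler_powR ?(ltW q0) //; lra.
  have -> : p%:~R = q%:R * a - (q%:R * a - p%:~R) by ring.
  apply: le_trans (ler_normB _ _) _; rewrite normrM ger0_norm ?(ltW q0) //.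
  rewrite mulrDr mulr1; apply: lerD.
    by rewrite ler_wpM2r // ler_nat.
  by apply: le_trans (ltW h) _; apply: le_trans h1 _; rewrite ler_nat.
rewrite -intr_norm -[B%:R]/(B%:~R) ler_int => pB.
exists (`|(p + B%:Z)%R|%N, q); first by split=> /=; move: pB qk; clear; lia.
by rewrite /f /=; congr (_, _); move: pB; clear; lia.
Qed.

End Exponent.

(** * The lower bound at all large scales *)

Section Asymptotic.
Context {R : realType}.
Implicit Types (a beta x y c eta s t T : R) (q m l N h k : nat) (p n : int).

Lemma expr2_large T : exists k, forall m, (k <= m)%N -> T <= 2 ^+ m.
Proof.
have [T0|T0] := leP T 0.
  by exists 0%N => m _; apply: le_trans T0 _; rewrite exprn_ge0.
have /andP[_ h] := truncn_itv (ltW T0).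
exists (Num.truncn T).+1 => m hm; apply: le_trans (ltW h) _.
rewrite -natrX ler_nat; apply: leq_trans hm _; exact: ltnW (ltn_expl _ _).
Qed.

Lemma least_denom_large a c eta T : 0 < c -> eta <= 2 ->
  (forall k n, (0 < k)%N -> c * k%:R `^ (- eta) <= `|k%:R * a - n%:~R|) ->
  exists k, forall m q p, (k <= m)%N -> least_denom a m q p -> T <= q%:R.
Proof.
move=> c0 eta2 liou; have [k hk] := expr2_large (T ^+ 2 / c).
exists k => m q p km [q_gt0 hq _].
have q0 : 0 < q%:R :> R by rewrite ltr0n.
have h2 : c * q%:R ^- 2 < 2^-1 ^+ m.
  apply: le_lt_trans hq; apply: le_trans (liou q p q_gt0); rewrite ler_pM2l //.
  rewrite -powR_mulrn ?(ltW q0) // -powRN; apply: ler_powR; last by lra.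
  by rewrite ler1n.
have {}hk := hk _ km.
have lt2 : T ^+ 2 < q%:R ^+ 2.
  apply: (@le_lt_trans _ _ (c * 2 ^+ m)); first by rewrite mulrC -ler_pdivrMr.
  by move: h2; rewrite ltr_pdivrMr ?exprn_gt0 // exprVn mulrC ltr_pdivlMr ?exprn_gt0.
rewrite leNgt; apply/negP => qT; move: lt2; apply/negP; rewrite -leNgt.
by rewrite lerXn2r ?nnegrE ?ltW // (lt_trans q0).
Qed.

(** The golden ratio is the positive root of [t^2 - t - 1]; [81 / 50] is a rational upper bound for
    it that leaves room below [7 / 4]. *)
Lemma golden_le t : t <= golden_ratio -> 1 <= t ->
  t <= 81 / 50 /\ t - 1 - t^-1 <= 0.
Proof.
rewrite /golden_ratio => t1 t2.
have s5 : Num.sqrt 5 ^+ 2 = 5 :> R by rewrite sqr_sqrtr.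
have s0 : 0 <= Num.sqrt 5 :> R by exact: sqrtr_ge0.
move: (Num.sqrt 5) s5 s0 t1 => w s5 s0 t1.
have w2 : w <= 56 / 25.
  rewrite leNgt; apply/negP => h.
  have : (56 / 25) ^+ 2 < w ^+ 2 by rewrite ltrXn2r // nnegrE //; lra.
  by rewrite s5; lra.
split; first by lra.
have t0 : 0 < t by lra.
rewrite -(pmulr_rle0 _ t0).
have -> : t * (t - 1 - t^-1) = (t - (1 + w) / 2) * (t + (1 + w) / 2 - 1)
    + (w ^+ 2 - 5) / 4 by field; rewrite gt_eqF.
rewrite s5 subrr mul0r addr0 mulr_le0_ge0 //; lra.
Qed.

Lemma eta_bound t s : 1 <= t -> t - 1 - t^-1 <= 0 -> 0 < s ->
  t + s - 1 - (t + s)^-1 <= 2 * s.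
Proof.
move=> t1 h s0; have t0 : 0 < t by lra.
have ts : 0 < t + s by lra.
have : t^-1 - s <= (t + s)^-1.
  rewrite -[(t + s)^-1]mul1r ler_pdivlMr //.
  have -> : (t^-1 - s) * (t + s) = 1 + s * t^-1 - s * t - s * s.
    by field; rewrite gt_eqF.
  have h1 : s * t^-1 <= s.
    by rewrite ger_pMr // invf_le1.
  have h2 : s <= s * t by rewrite ler_pMr.
  have h3 : 0 <= s * s by rewrite mulr_ge0 // ltW.
  by lra.
by lra.
Qed.

(** The loss is [l = m / h], rounded down, and [eta = t + 1 / (2 h)] exceeds [t] so little that the
    golden ratio defect [1 / h] satisfies [m / h <= l + 1]. The two regimes are [rho > 2^-l] and
    [rho <= 2^-l]. *)
Lemma core_asymptotic a beta t x y h M0 (Q : nat -> nat) (P : nat -> int) :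
  irrational a -> irr_exponent a = (t + 1)%:E -> 1 <= t -> t <= golden_ratio ->
  0 < beta -> beta < 1 -> (8 <= h)%N ->
  (forall m, least_denom a m (Q m) (P m)) ->
  (forall m, (M0 <= m)%N -> forall n : int,
     8 * 2^-1 ^+ (m %/ h) <= `|(Q m)%:R * (y - x) - n%:~R|) ->
  exists M1, forall m N, (M1 <= m)%N -> (2 ^ m * Q m <= N)%N ->
    (2 ^ m <= min_edits (xi_word a beta N x) (xi_word a beta N y)
      * 2 ^ (6 * (m %/ h)))%N.
Proof.
move=> irr mu t1 tg b0 b1 h8 hQ typ.
have [t81 tt] := golden_le tg t1.
have h0 : 0 < h%:R :> R by rewrite ltr0n; apply: leq_trans h8.
have h8' : 8 <= h%:R :> R by rewrite ler_nat.
have [s sE] : exists s, s = (2 * h%:R)^-1 :> R by eexists.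
have s0 : 0 < s by rewrite sE invr_gt0 mulr_gt0.
have s16 : s <= 16^-1.
  by rewrite sE lef_pV2 ?posrE ?mulr_gt0 //; move: h8'; clear; lra.
have [eta etaE] : exists eta, eta = t + s by eexists.
have eta1 : 1 <= eta by rewrite etaE; move: t1 s0; clear; lra.
have eta74 : eta <= 7 / 4 by rewrite etaE; move: t81 s16; clear; lra.
have etas : eta - 1 - eta^-1 <= 2 * s by rewrite etaE; exact: eta_bound.
have [c c0 liou] : exists2 c, 0 < c & forall q p, (0 < q)%N ->
    c * q%:R `^ (- eta) <= `|q%:R * a - p%:~R|.
  have [|c c0 hc] := @liouville_bound _ a (eta + 1) irr.
    by rewrite mu lte_fin etaE; move: s0; clear; lra.
  exists c => // q p q0; have := hc q p q0.
  by have -> : 1 - (eta + 1) = - eta by ring.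
have Dgt0 : 0 < c * (c / 2) `^ eta^-1 by rewrite mulr_gt0 // powR_gt0 // divr_gt0.
have eta2 : eta <= 2 by move: eta74; clear; lra.
have [k1 hk1] := expr2_large (25 / (c * (c / 2) `^ eta^-1)).
have [k2 hk2] := expr2_large ((3 / c) ^+ 4).
have [k3 hk3] := @least_denom_large a c eta (3 / beta + 3 / (1 - beta) + 2 / c)
  c0 eta2 liou.
have b1' : 0 < 1 - beta by rewrite subr_gt0.
(* The first regime also uses scale [m - 4 l], which is at least [m / 2] as [h >= 8]; hence
   [2 * M0]. *)
exists (maxn (maxn (k1.+1 * h) k2) (maxn k3 (2 * M0))) => m N.
rewrite !geq_max => /andP[/andP[mk1 mk2] /andP[mk3 mM]] hN.
have [l lE] : exists l, l = (m %/ h)%N by eexists.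
have lk : (k1.+1 <= l)%N by rewrite lE leq_divRL //; apply: leq_trans h8.
have lh : (l * h <= m)%N by rewrite lE leq_trunc_div.
have l8 : (l * 8 <= m)%N by apply: leq_trans lh; rewrite leq_mul2l h8 orbT.
have q_gt0 : (0 < Q m)%N by have [] := hQ m.
have q0 : 0 < (Q m)%:R :> R by rewrite ltr0n.
have qbig := hk3 m (Q m) (P m) mk3 (hQ m).
have i1 : 0 < 3 / beta by rewrite divr_gt0.
have i2 : 0 < 3 / (1 - beta) by rewrite divr_gt0.
have i3 : 0 < 2 / c by rewrite divr_gt0.
have qb : 3 / (Q m)%:R <= beta.
  rewrite ler_pdivrMr // mulrC -ler_pdivrMr //.
  by move: qbig i1 i2 i3; clear; lra.
have qb' : 3 / (Q m)%:R <= 1 - beta.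
  rewrite ler_pdivrMr // mulrC -ler_pdivrMr //.
  by move: qbig i1 i2 i3; clear; lra.
have typm : forall n : int, 8 * 2^-1 ^+ l <= `|(Q m)%:R * (y - x) - n%:~R|.
  by rewrite lE; apply: typ; apply: leq_trans mM; rewrite leq_pmull.
have [big|small] := ltP (2^-1 ^+ l) ((Q m)%:R * `|(Q m)%:R * a - (P m)%:~R|).
  rewrite -lE; apply: (core_near (hQ m) (hQ (m - 4 * l)%N)) => //.
    by move: l8; clear; lia.
  move=> n; apply: le_trans (typ (m - 4 * l)%N _ n); last first.
    by move: mM l8; clear; lia.
  rewrite ler_pM2l // lE ler_wiXn2l // ?invr_ge0 // ?invf_le1 ?ler1n //.
  by apply: leq_div2r; exact: leq_subr.
rewrite -lE; apply: (@core_far _ a beta x y (Q m) (P m) m l N c eta (2 * s)) => //.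
- by rewrite mulr_ge0 // ltW.
- by apply: leq_trans lk.
- have -> : 2 * s = h%:R^-1 by rewrite sE; field; rewrite gt_eqF.
  rewrite mulrC ler_pdivrMr // -natrM ler_nat lE ltnW // ltn_ceil //.
  by apply: leq_trans h8.
- rewrite mulrC -ler_pdivrMr //; move: qbig i1 i2 i3; clear; lra.
- have c30 : 0 <= 3 / c by rewrite divr_ge0 // ltW.
  have -> : 3 / c = ((3 / c) ^+ 4) `^ 4^-1.
    rewrite -powR_mulrn // -powRrM mulfV ?powRr1 //.
  by apply: powR_le_base; rewrite ?invr_ge0 ?exprn_ge0 //; exact: hk2.
- have : 25 / (c * (c / 2) `^ eta^-1) <= 2 ^+ (5 * l).
    by apply: hk1; move: lk; clear; lia.
  rewrite ler_pdivrMr // mulrC; apply: lt_le_trans.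
  by rewrite ltr_nat.
Qed.

End Asymptotic.

(** * Exponents *)

Section LimSup.
Local Open Scope classical_set_scope.
Local Open Scope ring_scope.
Context {R : realType}.
Implicit Types (u v : (\bar R)^nat) (c : R).

Lemma limn_esup_le_real u c :
  (forall e : R, 0 < e -> exists N0, forall N, (N0 <= N)%N -> (u N <= (c + e)%:E)%E) ->
  (limn_esup u <= c%:E)%E.
Proof.
move=> h; apply/lee_addgt0Pr => e e0; have [N0 hN] := h e e0.
apply: (@le_trans _ _ (ereal_sup [set u n | n in [set n | (N0 <= n)%N]])).
  by apply: ereal_inf_lbound; exists [set n | (N0 <= n)%N] => //; exists N0.
by apply/ereal_supP => _ [n hn <-]; rewrite -EFinD; exact: hN.
Qed.

Lemma limn_esup_ge_real u c :
  (forall (e : R) N0, 0 < e -> exists2 N, (N0 <= N)%N & ((c - e)%:E <= u N)%E) ->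
  (c%:E <= limn_esup u)%E.
Proof.
move=> h; apply/lee_subgt0Pr => e e0.
apply/ereal_infP => _ [V [N0 _ hV] <-].
have [N hN hu] := h e N0 e0; rewrite -EFinB; apply: le_trans hu _.
by apply: ereal_sup_ubound; exists N => //; exact: hV.
Qed.

Lemma limn_esup_le_near u v N0 : (forall N, (N0 <= N)%N -> (u N <= v N)%E) ->
  (limn_esup u <= limn_esup v)%E.
Proof.
move=> uv; apply/ereal_infP => _ [V [N1 _ hV] <-].
apply: (@le_trans _ _ (ereal_sup [set u n | n in [set n | (maxn N0 N1 <= n)%N]])).
  apply: ereal_inf_lbound; exists [set n | (maxn N0 N1 <= n)%N] => //.
  by exists (maxn N0 N1).
apply/ereal_supP => _ [n /= hn <-]; move: hn; rewrite geq_max => /andP[h0 h1].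
apply: le_trans (uv n h0) _; apply: ereal_sup_ubound; exists n => //.
exact: hV.
Qed.

Lemma limn_einfE u : limn_einf u = (- limn_esup (-%E \o u))%E.
Proof. by rewrite limn_esupN oppeK. Qed.

Lemma limn_einf_ge_real u c :
  (forall e : R, 0 < e -> exists N0, forall N, (N0 <= N)%N -> ((c - e)%:E <= u N)%E) ->
  (c%:E <= limn_einf u)%E.
Proof.
move=> h; rewrite limn_einfE leeNr; apply: (@limn_esup_le_real _ (- c)) => e e0.
have [N0 hN] := h e e0; exists N0 => N /hN hu.
have -> : - c + e = - (c - e) by ring.
by rewrite /= EFinN leeN2.
Qed.

Lemma limn_einf_le_real u c :
  (forall (e : R) N0, 0 < e -> exists2 N, (N0 <= N)%N & (u N <= (c + e)%:E)%E) ->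
  (limn_einf u <= c%:E)%E.
Proof.
move=> h; rewrite limn_einfE leeNl; apply: (@limn_esup_ge_real _ (- c)) => e N0 e0.
have [N hN hu] := h e N0 e0; exists N => //.
have -> : - c - e = - (c + e) by ring.
by rewrite /= EFinN leeN2.
Qed.

Lemma limn_einf_le_near u v N0 : (forall N, (N0 <= N)%N -> (u N <= v N)%E) ->
  (limn_einf u <= limn_einf v)%E.
Proof.
move=> uv; rewrite !limn_einfE leeN2; apply: (@limn_esup_le_near _ _ N0) => N hN.
by rewrite /= leeN2; exact: uv.
Qed.

End LimSup.

Section LogRatio.
Local Open Scope classical_set_scope.
Local Open Scope ring_scope.
Context {R : realType}.
Implicit Types (a b : R^nat) (s : R) (N : nat).

Lemma lne_nat_gt0 N : (2 <= N)%N -> (0 < (lne N%:R%:E)^-1 :> \bar R)%E.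
Proof.
move=> hN; have N0 : 0 < N%:R :> R by rewrite ltr0n; apply: leq_trans hN.
have l0 : 0 < ln N%:R :> R by rewrite ln_gt0 // ltr1n.
by rewrite lne_EFin // inver gt_eqF // lte_fin invr_gt0.
Qed.

(** The value [a N = 0] is allowed, with logarithm [-oo]; [N >= 2] makes the divisor positive. *)
Lemma log_ratio_mono a b N : (2 <= N)%N -> 0 <= a N -> a N <= b N ->
  (log_ratio a N <= log_ratio b N)%E.
Proof.
move=> hN a0 ab; rewrite /log_ratio; apply: lee_wpmul2r.
  by rewrite ltW // lne_nat_gt0.
rewrite lee_lne ?lee_fin // in_itv /= ?lee_fin ?leey ?andbT //.
exact: le_trans ab.
Qed.

Lemma log_ratio_powR s N : (2 <= N)%N ->
  log_ratio (fun N => N%:R `^ s) N = s%:E.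
Proof.
move=> hN; have N0 : 0 < N%:R :> R by rewrite ltr0n; apply: leq_trans hN.
have l0 : 0 < ln N%:R :> R by rewrite ln_gt0 // ltr1n.
rewrite /log_ratio !lne_EFin ?powR_gt0 // inver gt_eqF // -EFinM ln_powR.
by rewrite mulfK // gt_eqF.
Qed.

Lemma log_ratio_le a s N : (2 <= N)%N -> 0 <= a N -> a N <= N%:R `^ s ->
  (log_ratio a N <= s%:E)%E.
Proof. by move=> hN a0 h; rewrite -(log_ratio_powR s hN); exact: log_ratio_mono. Qed.

Lemma log_ratio_ge a s N : (2 <= N)%N -> N%:R `^ s <= a N ->
  (s%:E <= log_ratio a N)%E.
Proof.
move=> hN h; rewrite -(log_ratio_powR s hN); apply: log_ratio_mono => //.
Qed.

End LogRatio.

Section Diameter.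
Local Open Scope classical_set_scope.
Local Open Scope ring_scope.
Context {R : realType}.
Implicit Types (a beta x y B : R) (N : nat).

Lemma dist_ge0 a beta N x y : 0 <= dist a beta N x y.
Proof. by rewrite /dist /edit_dist divr_ge0. Qed.

Lemma dist_leN a beta N x y : dist a beta N x y <= N%:R.
Proof.
rewrite /dist /edit_dist ler_pdivrMr // mulrC -natrM ler_nat.
have := @min_edits_shift _ false (xi_word a beta N x) (xi_word a beta N y) N.
rewrite !size_mkseq => /(_ erefl) /leq_trans; apply.
by rewrite subnn big_geq // muln0 addn0.
Qed.

Lemma dist_le_diam a beta N x y : torus x -> torus y ->
  dist a beta N x y <= edit_diam (words a beta N).
Proof.
move=> Tx Ty; apply: ub_le_sup.
  exists N%:R => _ [_ [x' _ <-] [_ [y' _ <-] <-]]; exact: dist_leN.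
by exists (xi_word a beta N x); [exists x|exists (xi_word a beta N y) => //; exists y].
Qed.

Lemma torus0 : torus (0 : R).
Proof. by rewrite /torus /= in_itv /= lexx ltr01. Qed.

Lemma diam_le a beta N B : (forall x y, dist a beta N x y <= B) ->
  edit_diam (words a beta N) <= B.
Proof.
move=> h; apply: ge_sup.
  exists (dist a beta N 0 0), (xi_word a beta N 0); first by exists 0 => //; exact: torus0.
  by exists (xi_word a beta N 0) => //; exists 0 => //; exact: torus0.
by move=> _ [_ [x' _ <-] [_ [y' _ <-] <-]]; exact: h.
Qed.

Lemma diam_ge0 a beta N : 0 <= edit_diam (words a beta N) :> R.
Proof. exact: le_trans (dist_ge0 a beta N 0 0) (dist_le_diam _ _ _ torus0 torus0). Qed.

End Diameter.

Section Powers.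
Context {R : realType}.
Implicit Types (s r T : R) (N m k : nat).

Lemma powR_nat_large s T : 0 < s ->
  exists N0, forall N, (N0 <= N)%N -> T <= N%:R `^ s.
Proof.
move=> s0; set T' := `|T| + 1.
have T'0 : 0 <= T' by rewrite addr_ge0.
have P0 : 0 <= T' `^ s^-1 by exact: powR_ge0.
have /andP[_ h] := truncn_itv P0.
exists (Num.truncn (T' `^ s^-1)).+1 => N hN.
have -> : T = T + 0 by rewrite addr0.
apply: (@le_trans _ _ T'); first by rewrite lerD // ler_norm.
have -> : T' = (T' `^ s^-1) `^ s by rewrite -powRrM mulVf ?gt_eqF // powRr1.
apply: powR_le_base => //; first exact: ltW.
by apply: le_trans (ltW h) _; rewrite ler_nat.
Qed.

Lemma pow2_between r : 1 <= r -> exists m, 2 ^+ m <= r /\ r < 2 ^+ m.+1.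
Proof.
move=> r1; have r0 : 0 <= r by apply: le_trans r1.
have /andP[h1 h2] := truncn_itv r0.
have n0 : (0 < Num.truncn r)%N.
  by rewrite -(ltr_nat R); rewrite -natr1 in h2; move: h2 r1; clear; lra.
have /andP[b1 b2] := trunc_log_bounds (isT : (1 < 2)%N) n0.
exists (trunc_log 2 (Num.truncn r)); split.
  by apply: le_trans h1; rewrite -natrX ler_nat.
by apply: lt_le_trans h2 _; rewrite -natrX ler_nat.
Qed.

Lemma pow2_lt_succ k m r : 2 ^+ k <= r -> r < 2 ^+ m.+1 -> (k <= m)%N.
Proof.
move=> h1 h2; have := le_lt_trans h1 h2.
by rewrite -!natrX ltr_nat ltn_exp2l.
Qed.

End Powers.

(** * Edit distances compared with powers of [N] *)

Section Bounds.
Context {R : realType}.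
Implicit Types (a beta x y c eta e t : R) (q m N k h : nat) (p n : int).

Lemma dist_upper a beta q p N x y : beta < 1 -> (3 <= q)%N -> coprime `|p| q ->
  q%:R * `|q%:R * a - p%:~R| < 1 ->
  dist a beta N x y <= q%:R + 12 * (N%:R / q%:R + 1).
Proof.
move=> b1 q3 cpq rho1; have := edits_upper N x y b1 q3 cpq rho1.
have q0 : 0 < q%:R :> R by rewrite ltr0n; apply: leq_trans q3.
rewrite -(ler_nat R) natrD !natrM -[(N %/ q).+1%:R]natr1.
have : (N %/ q)%:R <= N%:R / q%:R :> R.
  by rewrite ler_pdivlMr // -natrM ler_nat leq_trunc_div.
rewrite /dist /edit_dist ler_pdivrMr //; move: (N%:R / _) (_ %/ _)%:R.
move: (min_edits _ _)%:R q%:R => E Q v w; clear; lra.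
Qed.

Lemma diam_upper a beta t e : irrational a -> irr_exponent a = (t + 1)%:E ->
  1 <= t -> beta < 1 -> 0 < e ->
  exists N0, forall N, (N0 <= N)%N ->
    edit_diam (words a beta N) <= N%:R `^ (t / (t + 1) + e).
Proof.
move=> irr mu t1 b1 e0.
have [d dE] : exists d, d = e / 2 by eexists.
have d0 : 0 < d by rewrite dE divr_gt0.
have [eta etaE] : exists eta, eta = t + d by eexists.
have eta0 : 0 < eta by rewrite etaE; move: t1 d0; clear; lra.
have eta1 : 0 < 1 + eta by rewrite addr_gt0.
have t10 : 0 < t + 1 by move: t1; clear; lra.
(* With [2^m] about [N^sg] one has [D N^nu <= q <= N^sg]; since [sg + nu = 1], both [q] and [N / q]
   are [O(N^sg)]. *)
pose sg := eta / (1 + eta); pose nu := (1 + eta)^-1.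
have nu0 : 0 < nu by rewrite invr_gt0.
have sg0 : 0 < sg by rewrite divr_gt0.
have sgnu : sg + nu = 1 by rewrite /sg /nu; field; rewrite gt_eqF.
have sgeta : sg / eta = nu by rewrite /sg /nu; field; rewrite !gt_eqF.
have sgle : sg <= t / (t + 1) + d.
  have -> : sg = t / (t + 1) + d * ((1 + eta) * (t + 1))^-1.
    have eta1' : 0 < 1 + (t + d) by rewrite -etaE.
    by rewrite /sg etaE; field; rewrite !gt_eqF.
  rewrite lerD2l -[leRHS]mulr1 ler_pM2l // invf_le1 ?mulr_gt0 //.
  by rewrite mulr_ege1 //; rewrite ?etaE; move: t1 d0; clear; lra.
have [c c0 liou] : exists2 c, 0 < c & forall q p, (0 < q)%N ->
    c * q%:R `^ (- eta) <= `|q%:R * a - p%:~R|.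
  have [|c c0 hc] := @liouville_bound _ a (eta + 1) irr.
    by rewrite mu lte_fin etaE; move: d0; clear; lra.
  exists c => // q p q0; have := hc q p q0.
  by have -> : 1 - (eta + 1) = - eta by ring.
have [D DE] : exists D, D = (c / 2) `^ eta^-1 by eexists.
have D0 : 0 < D by rewrite DE powR_gt0 // divr_gt0.
have [N1 h1] := powR_nat_large (3 / D) nu0.
have [N2 h2] := powR_nat_large (13 + 12 / D) d0.
exists (maxn (maxn N1 N2) 1) => N; rewrite !geq_max => /andP[/andP[n1 n2] n3].
have {}h1 := h1 N n1; have {}h2 := h2 N n2.
have r1 : 1 <= N%:R :> R by rewrite ler1n.
move: h1 h2 r1; have [r rE] : exists r : R, r = N%:R by eexists.
rewrite -rE => h1 h2 r1.
have r0 : 0 < r by apply: lt_le_trans r1.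
have rs1 : 1 <= r `^ sg.
  by apply: (@le_trans _ _ (r `^ 0)); [rewrite powRr0|apply: ler_powR => //; exact: ltW].
have rs0 : 0 < r `^ sg by rewrite powR_gt0.
have [m [m1 m2]] := pow2_between rs1.
have [q [p ld]] := least_denom_exists a m.
have [q_gt0 hq _] := ld.
have q0 : 0 < q%:R :> R by rewrite ltr0n.
have qle : q%:R <= r `^ sg.
  by apply: le_trans m1; rewrite -natrX ler_nat; exact: least_denom_le ld.
have qge : D * r `^ nu <= q%:R.
  have -> : q%:R = (q%:R `^ eta) `^ eta^-1 :> R.
    by rewrite -powRrM mulfV ?gt_eqF // powRr1 // ltW.
  have -> : D * r `^ nu = (c / 2 * r `^ sg) `^ eta^-1.
    by rewrite powRM ?powR_ge0 ?divr_ge0 ?(ltW c0) // DE -powRrM sgeta.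
  apply: powR_le_base; first by rewrite invr_ge0 ltW.
    by rewrite !mulr_ge0 ?powR_ge0 ?invr_ge0 // ltW.
  have := le_lt_trans (liou q p q_gt0) hq.
  rewrite powRN ltr_pdivrMr ?powR_gt0 // exprVn mulrC ltr_pdivlMr ?exprn_gt0 //.
  move=> h; apply: (@le_trans _ _ (c * 2 ^+ m)); last exact: ltW.
  rewrite -mulrA ler_pM2l // mulrC ler_pdivrMr // -exprSr; exact: ltW.
have q3 : (3 <= q)%N.
  rewrite -(ler_nat R); apply: le_trans qge.
  by rewrite mulrC -ler_pdivrMr.
apply: diam_le => x y.
apply: le_trans (dist_upper _ _ _ b1 q3 (least_denom_coprime ld) (least_denom_rho ld)) _.
rewrite -rE.
apply: (@le_trans _ _ (r `^ d * r `^ sg)); last first.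
  rewrite -powRD_gt0 //; apply: ler_powR => //.
  by move: sgle; rewrite dE; clear; lra.
apply: (@le_trans _ _ ((13 + 12 / D) * r `^ sg)); last by rewrite ler_pM2r.
have rq : r / q%:R <= r `^ sg / D.
  rewrite ler_pdivrMr //; apply: (@le_trans _ _ (r `^ sg / D * (D * r `^ nu))).
    rewrite mulrA divfK ?gt_eqF // -powRD_gt0 // sgnu powRr1 //; exact: ltW.
  by rewrite ler_pM2l // divr_gt0.
have -> : (13 + 12 / D) * r `^ sg = 13 * r `^ sg + 12 * (r `^ sg / D) by ring.
move: rq qle rs1; move: (r `^ sg / D) (r / _) (r `^ sg) => A B C; clear; lra.
Qed.

Lemma diam_upper_often a beta t e N0 : irrational a ->
  irr_exponent a = (t + 1)%:E -> t <= golden_ratio -> 1 <= t -> beta < 1 -> 0 < e ->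
  exists2 N, (N0 <= N)%N & edit_diam (words a beta N) <= N%:R `^ (2^-1 + e).
Proof.
move=> irr mu tg t1 b1 e0.
have [t81 _] := golden_le tg t1.
have [c c0 liou] : exists2 c, 0 < c & forall q p, (0 < q)%N ->
    c * q%:R `^ (- 2) <= `|q%:R * a - p%:~R|.
  have [|c c0 hc] := @liouville_bound _ a 3 irr.
    by rewrite mu lte_fin; move: t81; clear; lra.
  exists c => // q p q0; have := hc q p q0.
  by have -> : 1 - 3 = - 2 :> R by ring.
have e20 : 0 < 2 * e by rewrite mulr_gt0.
have [N1 h1] := powR_nat_large 25 e20.
have [k hk] := least_denom_large (maxn (maxn N0 N1) 3)%:R c0 (lexx 2) liou.
have [q [p ld]] := least_denom_exists a k.
have := hk k q p (leqnn k) ld; rewrite ler_nat !geq_max => /andP[/andP[qN0 qN1] q3].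
have q_gt0 : (0 < q)%N by apply: leq_trans q3.
have q0 : 0 < q%:R :> R by rewrite ltr0n.
have q1 : 1 <= q%:R :> R by rewrite ler1n.
(* For [N = q^2] the terms [q] and [N / q] agree, and [q + 12 (q + 1) <= 25 q]. *)
exists (q * q)%N; first by apply: leq_trans qN0 _; rewrite leq_pmulr.
apply: diam_le => x y.
apply: le_trans (dist_upper _ _ _ b1 q3 (least_denom_coprime ld) (least_denom_rho ld)) _.
rewrite natrM mulfK ?gt_eqF //.
apply: (@le_trans _ _ (25 * q%:R)); first by move: q1; clear; lra.
apply: (@le_trans _ _ (q%:R `^ (2 * e) * q%:R)).
  by rewrite ler_pM2r //; exact: h1.
rewrite powRM ?(ltW q0) // -powRD_gt0 //.
have -> : 2^-1 + e + (2^-1 + e) = 2 * e + 1 :> R by field.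
by rewrite powRD_gt0 // powRr1 // ltW.
Qed.

(** This isolates what typicality yields for a pair; [6 / h] is an arbitrarily small loss in the
    exponent. *)
Definition hard_pair a beta (Q : nat -> nat) x y := forall h, (8 <= h)%N ->
  exists M1, forall m N, (M1 <= m)%N -> (2 ^ m * Q m <= N)%N ->
    (2 ^ m <= min_edits (xi_word a beta N x) (xi_word a beta N y)
      * 2 ^ (6 * (m %/ h)))%N.

Lemma hard_pair_dist a beta Q x y e : hard_pair a beta Q x y -> 0 < e ->
  exists M1, forall m N, (M1 <= m)%N -> (2 ^ m * Q m <= N)%N ->
    2 `^ (m%:R * (1 - e) - 1) <= dist a beta N x y.
Proof.
move=> hard e0.
have h60 : 0 <= 6 / e by rewrite divr_ge0 // ltW.
have /andP[_ hh] := truncn_itv h60.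
set h := maxn (Num.truncn (6 / e)).+1 8.
have h8 : (8 <= h)%N by rewrite leq_maxr.
have h0 : 0 < h%:R :> R by rewrite ltr0n; apply: leq_trans h8.
have eh : 6 <= h%:R * e.
  rewrite -ler_pdivrMr //; apply: le_trans (ltW hh) _.
  by rewrite ler_nat leq_maxl.
have [M1 H] := hard h h8; exists M1 => m N hm hN.
have := H m N hm hN; rewrite -(ler_nat R) natrM !natrX /dist /edit_dist.
rewrite -!powR_mulrn // -ler_pdivrMr ?powR_gt0 // -powRN => hE.
rewrite powRD_gt0 // powR_inv1 // ler_pM2r ?invr_gt0 //.
apply: le_trans hE; rewrite -powRD_gt0 //; apply: ler_powR; first by rewrite ler1n.
rewrite mulrBr mulr1 lerD2l lerN2 natrM.
have : (m %/ h)%:R * h%:R <= m%:R :> R by rewrite -natrM ler_nat leq_trunc_div.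
have l0 : 0 <= (m %/ h)%:R :> R by [].
move=> lh; apply: (@le_trans _ _ ((m %/ h)%:R * h%:R * e)).
  by rewrite -mulrA mulrC ler_wpM2l.
by rewrite ler_pM2r.
Qed.

Lemma hard_pair_half a beta Q (P : nat -> int) x y e :
  (forall m, least_denom a m (Q m) (P m)) -> hard_pair a beta Q x y -> 0 < e ->
  exists N0, forall N, (N0 <= N)%N -> N%:R `^ (2^-1 - e) <= dist a beta N x y.
Proof.
move=> hQ hard e0; have [M1 H] := hard_pair_dist hard e0.
have h20 : 0 <= 2 / e by rewrite divr_ge0 // ltW.
have /andP[_ hh] := truncn_itv h20.
pose k := maxn M1 (Num.truncn (2 / e)).+1.
exists (4 ^ k)%N => N hN.
have r1 : 1 <= N%:R :> R by rewrite ler1n; apply: leq_trans hN; rewrite expn_gt0.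
have r0 : 0 < N%:R :> R by apply: lt_le_trans r1.
have [w wE] : exists w : R, w = N%:R `^ 2^-1 by eexists.
have ww : w * w = N%:R.
  rewrite wE -powRD_gt0 //; have -> : 2^-1 + 2^-1 = 1 :> R by field.
  by rewrite powRr1 // ltW.
have w0 : 0 < w by rewrite wE powR_gt0.
have kw : 2 ^+ k <= w.
  rewrite -(ler_pXn2r (isT : (0 < 2)%N)) ?nnegrE ?exprn_ge0 ?(ltW w0) //.
  rewrite [leRHS]expr2 ww -exprM mulnC exprM -!natrX ler_nat.
  by apply: leq_trans hN.
have w1 : 1 <= w by apply: le_trans kw; rewrite exprn_ege1 // ler1n.
have [m [m1 m2]] := pow2_between w1.
have km := pow2_lt_succ kw m2.
have := km; rewrite geq_max => /andP[M1m em].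
have hm : (2 ^ m * Q m <= N)%N.
  rewrite -(ler_nat R) natrM natrX -ww; apply: ler_pM; rewrite ?exprn_ge0 //.
  by apply: le_trans m1; rewrite -natrX ler_nat; exact: least_denom_le (hQ m).
apply: le_trans (H m N M1m hm).
(* One factor 2 is lost by rounding [w] to a power of 2, another by the halving in the edit
   distance. *)
have me : 2 <= m%:R * e.
  rewrite -ler_pdivrMr //; apply: le_trans (ltW hh) _.
  by rewrite ler_nat.
have -> : N%:R `^ (2^-1 - e) = w * w `^ (- (2 * e)).
  by rewrite powRD_gt0 // wE -powRrM; congr (_ * _ `^ _); field.
apply: (@le_trans _ _ (2 `^ m.+1%:R * (2 ^+ m) `^ (- (2 * e)))).
  apply: ler_pM; [exact: ltW|exact: powR_ge0| |].
    by rewrite powR_mulrn //; exact: ltW.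
  rewrite !powRN lef_pV2 ?posrE ?powR_gt0 ?exprn_gt0 //.
  by apply: powR_le_base => //; rewrite ?exprn_ge0 // mulr_ge0 // ltW.
rewrite -powR_mulrn // -powRrM -powRD_gt0 //; apply: ler_powR; first by rewrite ler1n.
by rewrite -natr1; move: me; clear; lra.
Qed.

(** A very good approximation keeps [Q m] down to about [2^(m / t)], so the lower bound of about
    [2^m] already holds for [N] about [2^(m (1 + 1 / t))]. *)
Lemma hard_pair_often a beta Q (P : nat -> int) x y t e N0 : irrational a ->
  irr_exponent a = (t + 1)%:E -> 1 <= t ->
  (forall m, least_denom a m (Q m) (P m)) -> hard_pair a beta Q x y -> 0 < e ->
  exists2 N, (N0 <= N)%N & N%:R `^ (t / (t + 1) - e) <= dist a beta N x y.
Proof.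
move=> irr mu t1 hQ hard e0.
have e40 : 0 < e / 4 by rewrite divr_gt0.
have [M1 H] := hard_pair_dist hard e40.
(* This value is at most both [e / 4] and [1 / 2]. *)
have [d dE] : exists d, d = e / (4 + 2 * e) by eexists.
have e4 : 0 < 4 + 2 * e by move: e0; clear; lra.
have d0 : 0 < d by rewrite dE divr_gt0.
have d1 : d <= e / 4.
  by rewrite dE ler_pM2l // lef_pV2 ?posrE //; move: e0; clear; lra.
have d2 : d <= 2^-1 by rewrite dE ler_pdivrMr //; move: e0; clear; lra.
have [eta etaE] : exists eta, eta = t - d by eexists.
have eta2 : 2^-1 <= eta by rewrite etaE; move: t1 d2; clear; lra.
have eta0 : 0 < eta by apply: lt_le_trans eta2; rewrite invr_gt0.
have t0 : 0 < t by apply: lt_le_trans t1.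
have t10 : 0 < t + 1 by rewrite addr_gt0.
have [s sE] : exists s, s = t / (t + 1) by eexists.
have s0 : 0 < s by rewrite sE divr_gt0.
have s1 : s <= 1 by rewrite sE ler_pdivrMr // mul1r lerDl.
have sd : s * (1 + eta^-1) <= 1 + d.
  have -> : s * (1 + eta^-1) = 1 + d * ((t + 1) * eta)^-1.
    have eta0' : 0 < t - d by rewrite -etaE.
    by rewrite sE etaE; field; rewrite !gt_eqF.
  rewrite lerD2l -[leRHS]mulr1 ler_pM2l // invf_le1 ?mulr_gt0 //.
  apply: (@le_trans _ _ (2 * 2^-1)); first by rewrite mulfV.
  by apply: ler_pM => //; move: t1; clear; lra.
have se : s * eta^-1 <= 2.
  rewrite ler_pdivrMr //; apply: le_trans s1 _.
  by move: eta2; clear; lra.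
have h60 : 0 <= 6 / e by rewrite divr_ge0 // ltW.
have /andP[_ hh] := truncn_itv h60.
pose k := maxn (maxn M1 N0) (Num.truncn (6 / e)).+1.
have [||q [p [kq hq]]] := @good_approximations _ a (eta + 1) (4 ^ k) irr.
- by rewrite addr_ge0 // ltW.
- by rewrite mu lte_fin ltrD2r etaE; move: d0; clear; lra.
have q_gt0 : (0 < q)%N by apply: leq_trans kq.
have q0 : 0 < q%:R :> R by rewrite ltr0n.
have q1 : 1 <= q%:R :> R by rewrite ler1n.
have kq' : 2 ^+ k <= q%:R `^ eta.
  apply: (@le_trans _ _ (q%:R `^ 2^-1)); last exact: ler_powR.
  have -> : 2 ^+ k = ((4 ^ k)%N%:R) `^ 2^-1 :> R.
    rewrite -[4%N]/((2 ^ 2)%N) -expnM mulnC expnM natrX -[_ ^+ 2]powR_mulrn // -powRrM.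
    by rewrite mulfV // powRr1 // natrX.
  by apply: powR_le_base; rewrite ?invr_ge0 // ler_nat ltnW.
have [|m [m1 m2]] := @pow2_between _ (q%:R `^ eta).
  by apply: le_trans kq'; rewrite exprn_ege1 // ler1n.
have km := pow2_lt_succ kq' m2.
have := km; rewrite !geq_max => /andP[/andP[M1m N0m] em].
have Qq : (Q m <= q)%N.
  have [_ _ least] := hQ m; apply: (least q p q_gt0).
  have E1 : 1 - (eta + 1) = - eta by ring.
  rewrite E1 powRN in hq; apply: lt_le_trans hq _.
  by rewrite exprVn lef_pV2 ?posrE ?powR_gt0 ?exprn_gt0.
have Q0 : (0 < Q m)%N by have [] := hQ m.
exists (2 ^ m * Q m)%N.
  apply: leq_trans N0m _; apply: (@leq_trans (2 ^ m)%N).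
    exact: ltnW (ltn_expl _ _).
  by rewrite leq_pmulr.
apply: le_trans (H m _ M1m (leqnn _)).
have [r rE] : exists r : R, r = (2 ^ m * Q m)%N%:R by eexists.
have r2 : 2 ^+ m <= r.
  by rewrite rE -natrX ler_nat leq_pmulr.
have r0 : 0 < r by apply: lt_le_trans r2; rewrite exprn_gt0.
have rle : r <= 2 `^ (m%:R + m.+1%:R * eta^-1).
  rewrite rE natrM natrX powRD_gt0 // powR_mulrn //.
  rewrite ler_pM2l ?exprn_gt0 //; apply: (@le_trans _ _ q%:R); first by rewrite ler_nat.
  have -> : q%:R = (q%:R `^ eta) `^ eta^-1 :> R.
    by rewrite -powRrM mulfV ?gt_eqF // powRr1 // ltW.
  rewrite powRrM; apply: powR_le_base; [by rewrite invr_ge0 ltW|exact: powR_ge0|].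
  by rewrite powR_mulrn //; exact: ltW.
have me : 6 <= m%:R * e.
  rewrite -ler_pdivrMr //; apply: le_trans (ltW hh) _.
  by rewrite ler_nat.
rewrite -rE -sE powRD_gt0 //.
apply: (@le_trans _ _ (2 `^ ((m%:R + m.+1%:R * eta^-1) * s) * 2 `^ (- (m%:R * e)))).
  apply: ler_pM; [exact: powR_ge0|exact: powR_ge0| |].
    by rewrite powRrM; apply: powR_le_base => //; exact: ltW.
  rewrite !powRN lef_pV2 ?posrE ?powR_gt0 // powRrM powR_mulrn //.
  by apply: powR_le_base => //; rewrite ?exprn_ge0 // ltW.
rewrite -powRD_gt0 //; apply: ler_powR; first by rewrite ler1n.
have -> : (m%:R + m.+1%:R * eta^-1) * s = m%:R * (s * (1 + eta^-1)) + s * eta^-1.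
  by rewrite -natr1; ring.
have h1 : m%:R * (s * (1 + eta^-1)) <= m%:R + m%:R * d.
  by rewrite -{2}[m%:R]mulr1 -mulrDr ler_wpM2l.
have h2 : m%:R * d <= m%:R * e / 4 by rewrite -mulrA ler_wpM2l.
have -> : m%:R * (1 - e / 4) - 1 = m%:R - m%:R * e / 4 - 1 by ring.
move: h1 h2 se me.
move: (m%:R * (s * _)) (s * eta^-1) (m%:R * d) (m%:R * e) => A B C D.
by clear; lra.
Qed.

End Bounds.

(** * Almost every pair is hard *)

Section AlmostEverywhere.
Local Open Scope classical_set_scope.
Local Open Scope ring_scope.
Context {R : realType}.
Implicit Types (a beta t : R) (h k : nat).
Local Notation mu2 := (@lebesgue_measure R \x @lebesgue_measure R)%E.

Local Instance ae_filter_mu2 : Filter (nbhs (almost_everywhere mu2)).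
Proof.
exact: (@ae_filter_ringOfSetsType _ _ _ (mu2 : {measure set _ -> \bar R})).
Qed.

(** Each power [2^-j] occurs at most [h] times, which reduces the sum to a geometric series. *)
Lemma sum_half_divn_le h k : (0 < h)%N ->
  \sum_(0 <= i < k) 2^-1 ^+ (i %/ h) <= 2 * h%:R :> R.
Proof.
move=> h0.
have H j : \sum_(0 <= i < j * h) 2^-1 ^+ (i %/ h) = 2 * h%:R * (1 - 2^-1 ^+ j) :> R.
  elim: j => [|j IH]; first by rewrite big_geq // expr0 subrr mulr0.
  rewrite (@big_cat_nat _ _ _ (j * h)) //=; last by rewrite leq_mul2r leqnSn orbT.
  rewrite IH -{1}[(j * h)%N]add0n big_addn mulSn addnK big_nat.
  rewrite (eq_bigr (fun=> 2^-1 ^+ j)); last first.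
    by move=> i /andP[_ ih]; rewrite divnDMl // divn_small.
  rewrite -big_nat sumr_const_nat subn0 -[_ *+ h]mulr_natr exprS.
  by move: (2^-1 ^+ j) => z; field.
apply: (@le_trans _ _ (\sum_(0 <= i < k * h) 2^-1 ^+ (i %/ h))).
  rewrite [leRHS](@big_cat_nat _ _ _ k) //=; last by rewrite leq_pmulr.
  by rewrite lerDl sumr_ge0 // => i _; rewrite exprn_ge0 // invr_ge0.
rewrite H -[leRHS]mulr1 ler_wpM2l ?mulr_ge0 // lerBlDr lerDl exprn_ge0 //.
Qed.

Lemma ae_torus2_exists (P : R * R -> Prop) :
  {ae mu2, forall xy, (torus `*` torus) xy -> P xy} ->
  exists2 xy, (torus `*` torus) xy & P xy.
Proof.
move=> [A [mA A0 hA]]; apply: contrapT => H.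
have sub : (torus : set R) `*` torus `<=` A.
  move=> xy Txy; apply: hA => /= hP; apply: H; exists xy => //; exact: hP.
have mT : measurable (torus : set R) by exact: measurable_itv.
have : (mu2 (torus `*` torus) <= mu2 A)%E.
  by apply: le_measure => //; rewrite inE //; exact: measurableX.
have -> : mu2 (torus `*` torus) = 1%E.
  have -> : mu2 (torus `*` torus) =
      (lebesgue_measure (torus : set R) * lebesgue_measure (torus : set R))%E.
    exact: product_measure1E.
  rewrite /torus lebesgue_measure_itv /= lte_fin ltr01 oppr0 adde0.
  by rewrite mule1.
by rewrite A0 lee_fin ler10.
Qed.

Lemma ae_torus2_sub (P P' : R * R -> Prop) :
  (forall xy, (torus `*` torus) xy -> P xy -> P' xy) ->
  {ae mu2, forall xy, (torus `*` torus) xy -> P xy} ->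
  {ae mu2, forall xy, (torus `*` torus) xy -> P' xy}.
Proof. by move=> h; apply: filterS => xy hP Txy; apply: h => //; exact: hP. Qed.

(** Two almost everywhere values agree because both are attained at a common point of the torus
    squared. *)
Lemma ae_valueE (F : R -> R -> \bar R) (c : \bar R) :
  ae_const_torus2 F c -> ae_value F = c.
Proof.
move=> hc; rewrite /ae_value; case: xgetP => [c' _ hc'|/(_ c) //].
have [|[x y] Txy [e1 e2]] := @ae_torus2_exists
    (fun xy => F xy.1 xy.2 = c /\ F xy.1 xy.2 = c').
  move: hc hc'; rewrite /ae_const_torus2; apply: filterS2 => xy h1 h2 Txy.
  by split; [exact: h1|exact: h2].
by rewrite -e2.
Qed.

(** Borel-Cantelli is applied to the countably many [h] at once. The threshold is capped at 1 as
    [ae_far_from_lattice] demands; the cap is inactive once [m / h >= 3], because [8 / 2^3 = 1]. *)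
Lemma ae_hard_pair a beta t (Q : nat -> nat) (P : nat -> int) :
  irrational a -> irr_exponent a = (t + 1)%:E -> 1 <= t -> t <= golden_ratio ->
  0 < beta -> beta < 1 -> (forall m, least_denom a m (Q m) (P m)) ->
  {ae mu2, forall xy, (torus `*` torus) xy -> hard_pair a beta Q xy.1 xy.2}.
Proof.
move=> irr mu t1 tg b0 b1 hQ.
pose T h i : R := Num.min 1 (8 * 2^-1 ^+ (i %/ h)).
have : {ae mu2, forall xy, forall h, (torus `*` torus) xy ->
    exists M, forall m, (M <= m)%N -> forall n : int,
      T h.+1 m <= `|(Q m)%:R * (xy.2 - xy.1) - n%:~R|}.
  apply: ae_foralln => h.
  apply: (@ae_far_from_lattice _ Q (T h.+1) (8 * (2 * h.+1%:R))).
  - by move=> i; have [] := hQ i.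
  - move=> i; have z0 : 0 <= 2^-1 ^+ (i %/ h.+1) :> R by rewrite exprn_ge0 ?invr_ge0.
    by rewrite /T le_min ler01 mulr_ge0.
  - by move=> i; rewrite /T ge_min lexx.
  - move=> k; apply: (@le_trans _ _ (\sum_(0 <= i < k) 8 * 2^-1 ^+ (i %/ h.+1))).
      by apply: ler_sum => i _; rewrite /T ge_min lexx orbT.
    by rewrite -mulr_sumr ler_pM2l // sum_half_divn_le.
apply: filterS => xy H Txy h h8.
have hh : h = h.-1.+1 by rewrite prednK //; apply: leq_trans h8.
have [M hM] := H h.-1 Txy.
apply: (@core_asymptotic _ a beta t xy.1 xy.2 h (maxn M (3 * h)) Q P) => //.
move=> m; rewrite geq_max => /andP[Mm hm] n.
have := hM m Mm n; rewrite /T -hh; apply: le_trans.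
rewrite le_min lexx andbT.
have l3 : (3 <= m %/ h)%N by rewrite leq_divRL //; apply: leq_trans h8.
apply: (@le_trans _ _ (8 * 2^-1 ^+ 3)).
  by rewrite ler_pM2l // ler_wiXn2l // ?invr_ge0 // invf_le1 // ler1n.
by have -> : 8 * 2^-1 ^+ 3 = 1 :> R by field.
Qed.

End AlmostEverywhere.

Local Open Scope ereal_scope.

Theorem theorem3 (R : realType) (alpha : R) (alpha_irr : irrational alpha)
  (alpha_mu : irr_exponent alpha - 1 <= (@golden_ratio R)%:E)
  (beta : R) (beta_gt0 : (0 < beta)%R) (beta_lt1 : (beta < 1)%R) :
  [/\ Gamma_sup alpha beta = GammaL_sup alpha beta,
      GammaL_sup alpha beta = (irr_exponent alpha - 1) / irr_exponent alpha,
      Gamma_inf alpha beta = (2^-1)%:E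
    & GammaL_inf alpha beta =
        Order.min (2^-1)%:E ((irr_exponent alpha - 1)^-1)].
Proof.
(* The hypothesis makes the irrationality exponent finite, and Dirichlet makes it at least 2. *)
have [t mu [t1 tg]] : exists2 t : R, irr_exponent alpha = (t + 1)%:E &
    (1 <= t)%R /\ (t <= golden_ratio)%R.
  move: alpha_mu (irr_exponent_ge2 alpha_irr).
  case: (irr_exponent alpha) => [r| |] //=.
  rewrite -EFinB !lee_fin => h1 h2; exists (r - 1)%R; first by rewrite subrK.
  by split=> //; move: h2; clear; lra.
have t0 : (0 < t)%R by apply: lt_le_trans t1.
have t10 : (0 < t + 1)%R by rewrite addr_gt0.
have /choice[QP hQP] : forall m, exists qp : nat * int,
    least_denom alpha m qp.1 qp.2.
  by move=> m; have [q [p h]] := least_denom_exists alpha m; exists (q, p).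
pose Q m := (QP m).1; pose P m := (QP m).2.
have hQ m : least_denom alpha m (Q m) (P m) by exact: hQP.
have sup_le : Gamma_sup alpha beta <= (t / (t + 1))%:E.
  apply: limn_esup_le_real => e e0.
  have [N0 hN0] := diam_upper alpha_irr mu t1 beta_lt1 e0.
  exists (maxn N0 2) => N; rewrite geq_max => /andP[hN N2].
  by apply: log_ratio_le => //; [exact: diam_ge0|exact: hN0].
have inf_le : Gamma_inf alpha beta <= (2^-1)%:E.
  apply: limn_einf_le_real => e N0 e0.
  have [N] := diam_upper_often (maxn N0 2) alpha_irr mu tg t1 beta_lt1 e0.
  rewrite geq_max => /andP[hN N2] hd; exists N => //.
  by apply: log_ratio_le => //; exact: diam_ge0.
(* The exponents of a hard pair are squeezed between its lower bounds and the upper bounds for the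
   diameter, so all four values follow. *)
have pairE xy : (torus `*` torus)%classic xy -> hard_pair alpha beta Q xy.1 xy.2 ->
    [/\ limn_esup (log_ratio (fun N => dist alpha beta N xy.1 xy.2)) = (t / (t + 1))%:E,
      limn_einf (log_ratio (fun N => dist alpha beta N xy.1 xy.2)) = (2^-1)%:E,
      Gamma_sup alpha beta = (t / (t + 1))%:E
    & Gamma_inf alpha beta = (2^-1)%:E].
  move=> [/= Tx Ty] hard.
  have mono N : (2 <= N)%N ->
      log_ratio (fun N => dist alpha beta N xy.1 xy.2) N <=
      log_ratio (fun N => edit_diam (words alpha beta N)) N.
    by move=> N2; apply: log_ratio_mono => //; [exact: dist_ge0|exact: dist_le_diam].
  have sup_mono := limn_esup_le_near mono.
  have inf_mono := limn_einf_le_near mono.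
  have sup_ge : (t / (t + 1))%:E <=
      limn_esup (log_ratio (fun N => dist alpha beta N xy.1 xy.2)).
    apply: limn_esup_ge_real => e N0 e0.
    have [N] := hard_pair_often (maxn N0 2) alpha_irr mu t1 hQ hard e0.
    rewrite geq_max => /andP[hN N2] hd; exists N => //.
    exact: log_ratio_ge.
  have inf_ge : (2^-1)%:E <=
      limn_einf (log_ratio (fun N => dist alpha beta N xy.1 xy.2)).
    apply: limn_einf_ge_real => e e0.
    have [N0 hN0] := hard_pair_half hQ hard e0.
    exists (maxn N0 2) => N; rewrite geq_max => /andP[hN N2].
    by apply: log_ratio_ge => //; exact: hN0.
  split; apply/eqP; rewrite eq_le.
  - by rewrite sup_ge (le_trans sup_mono).
  - by rewrite inf_ge (le_trans inf_mono).
  - by rewrite sup_le (le_trans sup_ge).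
  - by rewrite inf_le (le_trans inf_ge).
have ae := ae_hard_pair alpha_irr mu t1 tg beta_gt0 beta_lt1 hQ.
(* A single hard pair determines both exponents of the diameter. *)
have [xy Txy hxy] := ae_torus2_exists ae.
have [_ _ supE infE] := pairE xy Txy hxy.
have supLE : GammaL_sup alpha beta = (t / (t + 1))%:E.
  apply: ae_valueE; apply: ae_torus2_sub ae => z Tz hz.
  by have [] := pairE z Tz hz.
have infLE : GammaL_inf alpha beta = (2^-1)%:E.
  apply: ae_valueE; apply: ae_torus2_sub ae => z Tz hz.
  by have [] := pairE z Tz hz.
have mu1 : irr_exponent alpha - 1 = t%:E.
  by rewrite mu -EFinB addrK.
split; first by rewrite supE supLE.
- by rewrite supLE mu1 mu inver gt_eqF // -EFinM.
- exact: infE.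
(* As [t <= 81 / 50 < 2], the minimum is [1 / 2]. *)
- rewrite infLE mu1 inver gt_eqF // min_l // lee_fin.
  have [t81 _] := golden_le tg t1.
  by rewrite lef_pV2 ?posrE //; move: t81; clear; lra.
Qed.
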